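(* Let $\phi$ be a faithful finite-dimensional complex representation of a compact semisimple Lie algebra $\mathfrak{g}$ such that the symmetric square $\mathrm{Sym}^2\phi$ is irreducible. Then, up to isomorphism of $\mathfrak{g}$ and outer automorphisms of $\mathfrak{g}$ (and equivalence of representations), one of the following holds: (1) $\mathfrak{g}=\mathfrak{sp}(\ell)$ with $\ell\ge1$, $\phi$ has highest weight $(1,0,\ldots,0)$ (dimension $2\ell$), and $\mathrm{Sym}^2\phi$ has highest weight $(2,0,\ldots,0)$ (dimension $(2\ell+1)\ell$); or (2) $\mathfrak{g}=\mathfrak{su}(\ell+1)$ with $\ell\ge1$, $\phi$ has highest weight $(1,0,\ldots,0)$ (dimension $\ell+1$), and $\mathrm{Sym}^2\phi$ has highest weight $(2,0,\ldots,0)$ (dimension $(\ell+1)(\ell+2)/2$).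
   Context: $\mathfrak{sp}(\ell)=\mathfrak{sp}(2\ell,\mathbb C)\cap\mathfrak{su}(2\ell)$. Irreducible representations of compact simple Lie algebras are labeled by highest weights $(x_1,\ldots,x_\ell)$, $x_j\in\mathbb Z_{\ge0}$ the coefficient of the $j$-th fundamental weight, with Bourbaki's ordering of simple roots. For a representation $\phi$ on $V=\mathbb C^d$, $\phi\otimes\phi$ acts on $V\otimes V$ by $\phi(g)\otimes\mathbb 1+\mathbb 1\otimes\phi(g)$, and $\mathrm{Sym}^2\phi$ is its restriction to the symmetric subspace $\mathrm{Sym}^2V$ spanned by $v_i\otimes v_j+v_j\otimes v_i$. *)

(* Defs.v *)
From HB Require Import structures.
From mathcomp Require Import all_boot all_order all_algebra.
From mathcomp Require Import complex reals.
Set Implicit Arguments. Unset Strict Implicit. Unset Printing Implicit Defensive.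
Import Order.TTheory GRing.Theory Num.Theory.
Local Open Scope ring_scope.
Local Open Scope complex_scope.

Section LieDefs.
Variable R : realType.
Local Notation C := R[i].

(* br is a Lie bracket on the real vector space g: bilinear (left linearity +
   alternation give right linearity), alternating, Jacobi identity. *)
Definition is_lie_bracket (g : lmodType R) (br : g -> g -> g) : Prop :=
  [/\ (forall (a : R) x y z, br (a *: x + y) z = a *: br x z + br y z),
      (forall x, br x x = 0) &
      (forall x y z, br x (br y z) + br y (br z x) + br z (br x y) = 0)].

Definition lie_semisimple (g : vectType R) (br : g -> g -> g) : Prop :=
  (exists x : g, x != 0) /\
  forall I : {vspace g},
    (forall x y, y \in I -> br x y \in I) ->
    (forall x y, x \in I -> y \in I -> br x y = 0) -> I = 0%VS.

Definition lie_compact (g : vectType R) (br : g -> g -> g) : Prop :=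
  exists B : g -> g -> R,
    [/\ (forall (a : R) x y z, B (a *: x + y) z = a * B x z + B y z),
        (forall x y, B x y = B y x),
        (forall x, x != 0 -> 0 < B x x) &
        (forall x y z, B (br x y) z + B y (br x z) = 0)].

Definition lie_rep (g : lmodType R) (br : g -> g -> g) d (phi : g -> 'M[C]_d) : Prop :=
  (forall (a : R) x y, phi (a *: x + y) = a%:C *: phi x + phi y) /\
  (forall x y, phi (br x y) = phi x *m phi y - phi y *m phi x).

Definition ctr m n (M : 'M[C]_(m, n)) : 'M[C]_(n, m) := (map_mx Num.conj M)^T.

(* Actions of an operator A in gl(V) on the representation spaces:
   - on V = C^d (column vectors): v |-> A v;
   - on Sym^2 V, realised as the space of symmetric d x d matrices via
     v_i (x) v_j + v_j (x) v_i |-> v_i v_j^T + v_j v_i^T :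
     S |-> A S + S A^T  (this is A (x) 1 + 1 (x) A). *)
Definition std_act d (A : 'M[C]_d) (v : 'cV[C]_d) : 'cV[C]_d := A *m v.
Definition sym2_act d (A : 'M[C]_d) (S : 'M[C]_d) : 'M[C]_d := A *m S + S *m A^T.

Definition sym2_space d : {vspace 'M[C]_d} :=
  lker (linfun (fun M : 'M[C]_d => M - M^T)).

Definition irreducible_on (A : Type) (dom : A -> Prop) m n d
    (act : 'M[C]_d -> 'M[C]_(m, n) -> 'M[C]_(m, n)) (rho : A -> 'M[C]_d)
    (W0 : {vspace 'M[C]_(m, n)}) : Prop :=
  W0 != 0%VS /\
  forall W : {vspace 'M[C]_(m, n)}, (W <= W0)%VS ->
    (forall X v, dom X -> v \in W -> act (rho X) v \in W) ->
    W = 0%VS \/ W = W0.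

(* complexified representation: for Z in the complexification k_C of a compact
   matrix algebra k (closed under X |-> -X^* ), Z = A + i B with
   A = (Z - Z^* )/2, B = (Z + Z^* )/(2i) in k, and rho_C(Z) = rho A + i rho B. *)
Definition cplx_rep N d (rho : 'M[C]_N -> 'M[C]_d) (Z : 'M[C]_N) : 'M[C]_d :=
  rho ((2%:R)^-1 *: (Z - ctr Z)) + 'i%C *: rho (((2%:R) * 'i%C)^-1 *: (Z + ctr Z)).

Definition su_mem n (X : 'M[C]_n) : Prop := ctr X = - X /\ \tr X = 0.

(* Positive root vectors of sl(l+1, C) (Cartan = diagonal): E_ij, i < j. *)
Definition su_pos l (E : 'M[C]_l.+1) : Prop :=
  exists i j : 'I_l.+1, (i < j)%N /\ E = delta_mx i j.

(* Simple coroots H_k = E_kk - E_{k+1,k+1}, k = 0..l-1 (Bourbaki order). *)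
Definition su_coroot l (k : 'I_l) : 'M[C]_l.+1 :=
  delta_mx (widen_ord (leqnSn l) k) (widen_ord (leqnSn l) k)
  - delta_mx (lift ord0 k) (lift ord0 k).

Definition sympJ l : 'M[C]_(l + l) := block_mx 0 1%:M (- 1%:M) 0.

(* sp(l) = sp(2l, C) cap su(2l) = { X : X^* = -X, X^T J + J X = 0 }
   (tracelessness is automatic). *)
Definition sp_mem l (X : 'M[C]_(l + l)) : Prop :=
  ctr X = - X /\ X^T *m sympJ l + sympJ l *m X = 0.

(* Positive root vectors of sp(2l, C) (Cartan = diag(h, -h)):
   roots e_i - e_j (i < j):  E_{i,j} - E_{l+j,l+i};
   roots e_i + e_j (i <= j): E_{i,l+j} + E_{j,l+i}. *)
Definition sp_pos l (E : 'M[C]_(l + l)) : Prop :=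
  (exists i j : 'I_l, (i < j)%N /\
     E = delta_mx (lshift l i) (lshift l j) - delta_mx (rshift l j) (rshift l i))
  \/ (exists i j : 'I_l, (i <= j)%N /\
     E = delta_mx (lshift l i) (rshift l j) + delta_mx (lshift l j) (rshift l i)).

Definition sp_h l (i : 'I_l) : 'M[C]_(l + l) :=
  delta_mx (lshift l i) (lshift l i) - delta_mx (rshift l i) (rshift l i).

(* Simple coroots in Bourbaki order: alpha_k = e_k - e_{k+1} (k < l-1),
   alpha_{l-1} = 2 e_{l-1} (0-based), coroots h_k - h_{k+1} resp. h_{l-1}. *)
Definition sp_coroot l (k : 'I_l) : 'M[C]_(l + l) :=
  if (k.+1 < l)%N then sp_h k - sp_h (insubd k k.+1) else sp_h k.

Definition hw_first l (c : nat) (k : 'I_l) : nat := if val k == 0%N then c else 0%N.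

(* rho (a representation of the compact algebra dom, acting through act on W0)
   is irreducible with highest weight x (coordinates w.r.t. the fundamental
   weights, i.e. the eigenvalues of the simple coroots on a highest weight
   vector). *)
Definition irrep_with_hw N l m n d (dom : 'M[C]_N -> Prop)
    (pos : 'M[C]_N -> Prop) (coroot : 'I_l -> 'M[C]_N)
    (act : 'M[C]_d -> 'M[C]_(m, n) -> 'M[C]_(m, n)) (rho : 'M[C]_N -> 'M[C]_d)
    (W0 : {vspace 'M[C]_(m, n)}) (x : 'I_l -> nat) : Prop :=
  irreducible_on dom act rho W0 /\
  exists v, [/\ v \in W0, v != 0,
    (forall E, pos E -> act (cplx_rep rho E) v = 0) &
    (forall k, act (cplx_rep rho (coroot k)) v = (x k)%:R *: v)].

Definition lie_iso_from N (dom : 'M[C]_N -> Prop) (g : lmodType R)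
    (br : g -> g -> g) (psi : 'M[C]_N -> g) : Prop :=
  [/\ (forall (a : R) X Y, dom X -> dom Y -> psi (a%:C *: X + Y) = a *: psi X + psi Y),
      (forall X Y, dom X -> dom Y -> psi (X *m Y - Y *m X) = br (psi X) (psi Y)),
      (forall X Y, dom X -> dom Y -> psi X = psi Y -> X = Y) &
      (forall y : g, exists2 X, dom X & psi X = y)].

End LieDefs.

(* Main.v *)
(* Let [X_i] be the images of an orthonormal basis of the compact algebra [g].  By
   Schur's lemma on [Sym^2 V], the operator [sum_i X_i (x) X_i] is scalar there.

   The [X_i] become skew-Hermitian after a conjugation minimizing [sum_i |X_i|^2]:
   the minimum exists by compactness and the irreducibility of [V], and at a minimum
   the moment [sum_i [X_i, X_i^*]] vanishes.

   Put [cas A = - sum_i tr (A X_i) X_i].  Diagonalize simultaneously all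
   [cas (e_i e_i^* )] for a suitable orthonormal basis [e_i].  The scalar identity on
   [Sym^2 V] forces the weights of the [e_i] to be distinct, of equal length, with all
   their differences roots; two weights [e_i], [e_j] and a third one [e_k] then form an
   equilateral or a right isosceles triangle.  If all triangles are equilateral, the
   weights form a simplex and [cas] is, up to a scalar, the projection of [gl(V)] onto
   [sl(V)].  Otherwise the weights form a cross-polytope, the antipodal pairs define a
   symplectic form, and [cas] is a multiple of the projection onto [sp(V)].  In either
   case the image of [cas] is the complexification of [g]. *)
Require Import Defs.
From HB Require Import structures.
From mathcomp Require Import all_boot all_order all_algebra.
From mathcomp Require Import complex reals.
From mathcomp Require Import boolp classical_sets topology normedtype derive.
From mathcomp Require Import ring lra.
Set Implicit Arguments. Unset Strict Implicit. Unset Printing Implicit Defensive.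
Import Order.TTheory GRing.Theory Num.Theory.
Local Open Scope ring_scope.
Local Open Scope complex_scope.
Local Open Scope sesquilinear_scope.

(** * Weights of a representation whose split Casimir is scalar on the symmetric square *)

(** No root system is invoked: the coefficients of [cas] in one basis carry all the structure. They
    are those of [sum_i X_i (x) X_i] with the indices regrouped, so scalarity on Sym^2 V becomes a
    linear relation between the matrices [cas (e_i e_j^* )]. That relation does two things. With two
    equal indices it computes how such a matrix acts on [e_j], namely by the distance of two
    weights. With distinct indices it is an antisymmetry, and this sign makes the form of the
    cross-polytope alternating, so that sp and not so occurs. Skew-Hermitian [X_i] turn the relevant
    coefficients into sums of squares, and this positivity drives the geometry of the weights. Only
    a Lie algebra is given, with no group to average over; a conjugate of least norm, in the manner
    of Kempf and Ness, supplies unitarity instead. Semisimplicity enters through the absence of a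
    center, which makes all traces vanish. *)

Lemma sub_mxE (V : zmodType) m n (A B : 'M[V]_(m, n)) i j : (A - B) i j = A i j - B i j.
Proof. by rewrite !mxE. Qed.

Lemma conjC_real (R : rcfType) (x : R) : (x%:C)^*%R = x%:C :> R[i].
Proof. by apply/eqP; rewrite eq_complex /= oppr0 !eqxx. Qed.

(* [E i j] stands for [cas X (delta_mx i j)] (see [cas] below) in an orthonormal
   basis [e_i] in which every [E i i] is diagonal.  Then [E i i] is dual to the
   weight of [e_i], so [wt i j] is the inner product of the weights of [e_i] and
   [e_j], all of squared length [c], and [gap i j] is half their squared distance.
   For [i != j], [E i j] is a root vector for the difference of the two weights. *)
Section SplitCasimirTensor.

Variables (R : rcfType) (d : nat) (c : R) (E : 'I_d -> 'I_d -> 'M[R[i]]_d).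

Hypothesis c_ge0 : 0 <= c.
Hypothesis E_diag : forall i k m, k != m -> E i i k m = 0.
Hypothesis E_sym2 : forall i j k m,
  E i j m k + E k j m i = c%:C * ((i == j)%:R * (m == k)%:R + (j == k)%:R * (m == i)%:R).
Hypothesis E_self : forall i j m k, E i j m k = E k m j i.
Hypothesis E_adj : forall i j m k, E j i k m = (E i j m k)^*%R.
Hypothesis E_comm : forall i j k l,
  E i j *m E k l - E k l *m E i j
  = \sum_m E i j m k *: E m l - \sum_m E i j l m *: E k m.
Hypothesis E_tr0 : forall i j, \tr (E i j) = 0.
Hypothesis E_ge0 : forall i j, 0 <= E i j i j.
Hypothesis E_eq0 : forall i j, E i j i j = 0 -> E i j = 0.
Hypothesis E_gram : forall i j,
  E i i i i + E j j j j = E i i j j + E j j i i -> E i i = E j j.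
Hypothesis E_neq0 : exists i j, E i j != 0.

Definition wt i j : R := complex.Re (E i i j j).
Definition gap i j : R := c - wt i j.

Lemma E_wt i j : E i i j j = (wt i j)%:C.
Proof.
have := E_adj i i j j; rewrite /wt; case: (E i i j j) => a b [] /= e.
by have -> : b = 0 by lra.
Qed.

Lemma wt_sym i j : wt i j = wt j i.
Proof. by rewrite /wt E_self. Qed.

Lemma gap_sym i j : gap i j = gap j i.
Proof. by rewrite /gap wt_sym. Qed.

Lemma E_swap i j k m : i != j -> k != j -> E i j m k = - E k j m i.
Proof.
move=> /negPf ij kj; apply/eqP; rewrite -addr_eq0 E_sym2 ij.
by rewrite [j == k]eq_sym (negPf kj) !mul0r addr0 mulr0.
Qed.

Lemma wt_diag i : wt i i = c.
Proof.
apply: complexI; rewrite -E_wt; have := E_sym2 i i i i.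
rewrite !eqxx !mulr1 => h; apply: (@mulIf _ 2%:R); first by rewrite pnatr_eq0.
by rewrite -h; ring.
Qed.

Lemma gap_diag i : gap i i = 0.
Proof. by rewrite /gap wt_diag subrr. Qed.

(** The Sym^2 relation with [k = j] pairs this column with the diagonal matrix [E j j]. So [E i j]
    sends [e_j] to [gap i j] times [e_i], and is nonzero as soon as the two weights differ. *)
Lemma E_col i j m : i != j -> E i j m j = (m == i)%:R * (gap i j)%:C.
Proof.
move=> ij; have := E_sym2 i j j m; rewrite (negPf ij) eqxx mul0r add0r mul1r.
have [-> | mi] := eqVneq m i.
  rewrite E_wt wt_sym mulr1 mul1r => /eqP; rewrite -subr_eq0 => /eqP e.
  by apply/eqP; rewrite -subr_eq0 -e /gap rmorphB /=; apply/eqP; ring.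
by rewrite (E_diag _ mi) addr0 mulr0 mul0r.
Qed.

Lemma E_row i j m : i != j -> E i j i m = (m == j)%:R * (gap i j)%:C.
Proof.
move=> ij; rewrite E_adj E_col 1?eq_sym // rmorphM /= conjC_nat gap_sym.
by congr (_ * _); apply: conjC_real.
Qed.

Lemma gap_ge0 i j : 0 <= gap i j.
Proof.
have [-> | ij] := eqVneq i j; first by rewrite gap_diag.
by have := E_ge0 i j; rewrite E_col // eqxx mul1r ler0c.
Qed.

Lemma gap_eq0_E i j : i != j -> gap i j = 0 -> E i j = 0.
Proof. by move=> ij g0; apply: E_eq0; rewrite E_col // g0 mulr0. Qed.

Lemma E_diag_mull n (A : 'M_d) m k : (E n n *m A) m k = (wt n m)%:C * A m k.
Proof.
rewrite mxE (bigD1 m) //= E_wt big1 ?addr0 // => p pm.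
by rewrite E_diag ?mul0r // eq_sym.
Qed.

Lemma E_diag_mulr n (A : 'M_d) m k : (A *m E n n) m k = A m k * (wt n k)%:C.
Proof.
rewrite mxE (bigD1 k) //= E_wt big1 ?addr0 // => p pm.
by rewrite E_diag ?mulr0.
Qed.

(** [E n n] is diagonal and [[E n n, E i j]] is [wt n i - wt n j] times [E i j]. Hence a nonzero
    entry says that the weight of [e_m] is that of [e_i] minus that of [e_j] plus that of [e_k],
    tested against every [n]. *)
Lemma E_weight i j m k : E i j m k != 0 ->
  forall n, wt n m = wt n i - wt n j + wt n k.
Proof.
move=> nz n; have /matrixP/(_ m k) := E_comm n n i j.
rewrite sub_mxE E_diag_mull E_diag_mulr.
have -> : (\sum_p E n n p i *: E p j) = (wt n i)%:C *: E i j.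
  rewrite (bigD1 i) //= E_wt big1 ?addr0 // => p pi.
  by rewrite E_diag // scale0r.
have -> : (\sum_p E n n j p *: E i p) = (wt n j)%:C *: E i j.
  rewrite (bigD1 j) //= E_wt big1 ?addr0 // => p pi.
  by rewrite E_diag ?scale0r // eq_sym.
rewrite !mxE => /eqP; rewrite [E i j m k * _]mulrC -!mulrBl => /eqP/(mulIf nz).
by rewrite -!rmorphB => /complexI; lra.
Qed.

Lemma gap_weight i j m k : E i j m k != 0 ->
  forall n, gap n m = gap n i - gap n j + gap n k.
Proof. by move=> nz n; rewrite /gap (E_weight nz); lra. Qed.

Lemma sum_wt i : \sum_k wt i k = 0.
Proof.
apply: complexI; rewrite rmorph_sum /= -[RHS](E_tr0 i i) /mxtrace.
by apply: eq_bigr => k _; rewrite E_wt.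
Qed.

(** If [c = 0], the nonnegative numbers [gap i k = - wt i k] sum to zero over [k] by tracelessness.
    All weights then vanish, and positivity kills every [E i j]. *)
Lemma c_gt0 : 0 < c.
Proof.
rewrite lt_neqAle c_ge0 andbT eq_sym; apply/eqP => c0.
have wt0 i j : wt i j = 0.
  have h k : true -> 0 <= - wt i k.
    by move=> _; have := gap_ge0 i k; rewrite /gap c0 sub0r.
  have : \sum_k - wt i k == 0 by rewrite sumrN sum_wt oppr0.
  by rewrite psumr_eq0 // => /allP/(_ j); rewrite mem_index_enum oppr_eq0 => /(_ isT)/eqP.
have [i [j /eqP[]]] := E_neq0; apply: E_eq0.
have [-> | ij] := eqVneq i j; first by rewrite E_wt wt0.
by rewrite E_col // /gap wt0 c0 subrr mulr0.
Qed.

Lemma cC_neq0 : c%:C != 0 :> R[i].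
Proof. by rewrite fmorph_eq0 gt_eqF ?c_gt0. Qed.

(* Multiplicity one: if [gap i j = 0] then [e_i] and [e_j] carry the same weight;
   for [k] of a different weight, [E k i] maps [e_i] to a multiple of [e_k] and
   [E j k] maps [e_k] to a multiple of [e_j], yet the two commute. *)
Lemma gap_gt0 i j : i != j -> 0 < gap i j.
Proof.
move=> ij; rewrite lt_neqAle gap_ge0 andbT eq_sym; apply/eqP => g0.
have ji : j != i by rewrite eq_sym.
have Eij := gap_eq0_E ij g0; have Eji : E j i = 0.
  by apply: gap_eq0_E; rewrite // gap_sym.
have hij : E i i = E j j.
  apply: E_gram; rewrite !E_wt !wt_diag [wt j i]wt_sym.
  by have -> : wt i j = c by move: g0; rewrite /gap; lra.
(* Otherwise all [wt i k] equal [c > 0], although their sum is zero. *)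
have [k gk] : exists k, gap i k != 0.
  apply/existsP; rewrite -negb_forall; apply/negP => /forallP h.
  have := sum_wt i; rewrite (eq_bigr (fun=> c)); last first.
    by move=> k _; move/eqP: (h k); rewrite /gap; lra.
  rewrite sumr_const card_ord => /eqP; rewrite mulrn_eq0 (gt_eqF c_gt0) orbF.
  by move=> /eqP d0; case: (i) => x; rewrite d0.
have ki : k != i by apply: contraNneq (gk) => ->; rewrite gap_diag.
have kj : k != j by apply: contraNneq (gk) => ->; rewrite g0.
have ik : i != k by rewrite eq_sym.
have jk : j != k by rewrite eq_sym.
have gjk : gap j k = gap i k by rewrite /gap /wt hij.
have Eikj m : E i k m j = 0.
  apply/eqP/negPn/negP => /gap_weight/(_ i); rewrite gap_diag g0 => g.
  by have := gap_ge0 i m; have := gap_ge0 i k; move: gk; rewrite g; lra.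
(* At the entry [(j, i)] the commutator reduces to [gap j k * gap k i], while the right-hand side is
   zero. *)
have /(congr1 (fun A : 'M_d => A j i)) := E_comm j k k i.
have -> : \sum_m E j k m k *: E m i = 0.
  rewrite big1 // => m _; rewrite E_col //.
  by have [-> | _] := eqVneq m j; rewrite ?Eji ?scaler0 // mul0r scale0r.
have -> : \sum_m E j k i m *: E k m = 0.
  rewrite big1 // => m _; rewrite E_adj E_swap // Eij mxE oppr0.
  by rewrite conjC0 scale0r.
rewrite sub_mxE [(E k i *m _) _ _]mxE [X in _ - X]big1; last first.
  by move=> m _; rewrite [E j k m i]E_swap // Eikj oppr0 mulr0.
rewrite mxE (bigD1 k) //= big1 => [|m mk]; last first.
  by rewrite E_row // (negPf mk) !mul0r.
rewrite E_row // E_col // eqxx !mul1r addr0 !subr0 mxE gjk [gap k i]gap_sym.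
by move/eqP; rewrite mulf_eq0 orbb => /eqP/complexI/eqP; apply/negP.
Qed.

(** The weights of [e_i], [e_j], [e_k], [e_m] are the consecutive vertices of a parallelogram. All
    have squared length [c], and a parallelogram inscribed in a sphere is a rectangle: the
    conclusion is Pythagoras with the right angle at [j]. *)
Lemma E_neq0_gap i j m k : i != j -> E i j m k != 0 -> gap i k = gap i j + gap j k.
Proof.
move=> ij nz; have w := gap_weight nz; have := w m; rewrite gap_diag.
rewrite ![gap m _]gap_sym !w !gap_diag [gap j i]gap_sym [gap k i]gap_sym.
by rewrite [gap k j]gap_sym; lra.
Qed.

Lemma E_uniq i j k m m' : E i j m k != 0 -> E i j m' k != 0 -> m = m'.
Proof.
move=> /gap_weight w /gap_weight w'; apply/eqP/negPn/negP => /gap_gt0.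
by rewrite w' -w gap_diag ltxx.
Qed.

(** This is the entry [(k, k)] of [[E i j, E j i]], which is [gap i j] times [E i i - E j j]. As
    [E j i] is the adjoint of [E i j], the products become sums of squared moduli. *)
Lemma E_col_norm i j k : i != j ->
  \sum_m `|E j i m k| ^+ 2 - \sum_m `|E i j m k| ^+ 2
  = (gap i j * (gap j k - gap i k))%:C.
Proof.
move=> ij; have ji : j != i by rewrite eq_sym.
have /(congr1 (fun A : 'M_d => A k k)) := E_comm i j j i.
have -> : \sum_m E i j m j *: E m i = (gap i j)%:C *: E i i.
  rewrite (bigD1 i) //= E_col // eqxx mul1r big1 ?addr0 // => m /negPf mi.
  by rewrite E_col // mi mul0r scale0r.
have -> : \sum_m E i j i m *: E j m = (gap i j)%:C *: E j j.
  rewrite (bigD1 j) //= E_row // eqxx mul1r big1 ?addr0 // => m /negPf mi.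
  by rewrite E_row // mi mul0r scale0r.
rewrite !sub_mxE !mxE !E_wt -!rmorphM -!rmorphB /= => h.
transitivity ((gap i j * wt i k - gap i j * wt j k)%:C).
  rewrite -h; congr (_ - _); apply: eq_bigr => m _.
    by rewrite [E i j k m]E_adj mulrC normCK.
  by rewrite [E j i k m]E_adj mulrC normCK.
by congr (_%:C); rewrite /gap; ring.
Qed.

(* In the [sl_2]-triple of [E i j] all weights of the module have the same length,
   so the weight of [e_k] is extremal: its string has at most two elements. *)
Lemma gap_trichotomy i j k : i != j ->
  [\/ gap i k = gap j k, gap i k = gap i j + gap j k | gap j k = gap i j + gap i k].
Proof.
move=> ij; have ji : j != i by rewrite eq_sym.
have [/existsP[m nz]|] := boolP [exists m, E i j m k != 0].
  by apply: Or32; apply: E_neq0_gap nz.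
rewrite negb_exists => /forallP z1.
have [/existsP[m nz]|] := boolP [exists m, E j i m k != 0].
  by apply: Or33; rewrite (E_neq0_gap ji nz) gap_sym.
rewrite negb_exists => /forallP z2.
apply: Or31; have := E_col_norm k ij.
rewrite !big1 ?subr0 => [|m _|m _]; last 2 first.
- by have := z1 m; rewrite negbK => /eqP->; rewrite normr0 expr0n.
- by have := z2 m; rewrite negbK => /eqP->; rewrite normr0 expr0n.
move/esym/complexI/eqP; rewrite mulf_eq0 gt_eqF ?gap_gt0 //= subr_eq0.
by move/eqP.
Qed.

(** The weight determines [m], and [E j i] kills [e_k] because a triangle has only one right angle.
    The norm identity is left with a single term, whose value follows from the right angle at
    [j]. *)
Lemma E_neq0_norm i j m k : i != j -> E i j m k != 0 -> `|E i j m k| = (gap i j)%:C.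
Proof.
move=> ij nz; have ji : j != i by rewrite eq_sym.
have g := E_neq0_gap ij nz; have := E_col_norm k ij.
rewrite [X in _ - X](bigD1 m) //= [X in _ - (_ + X)]big1 ?addr0 => [|p pm]; last first.
  have [-> |nz'] := eqVneq (E i j p k) 0; first by rewrite normr0 expr0n.
  by rewrite (E_uniq nz nz') eqxx in pm.
rewrite big1 => [|p _]; last first.
  have [-> |nz'] := eqVneq (E j i p k) 0; first by rewrite normr0 expr0n.
  by exfalso; have := E_neq0_gap ji nz'; have := gap_gt0 ij; rewrite g [gap j i]gap_sym; lra.
rewrite sub0r g => /eqP; rewrite eqr_oppLR -rmorphN /= => h.
apply/eqP; rewrite -(eqrXn2 (n := 2)) // ?ler0c ?gap_ge0 //.
by rewrite (eqP h) -rmorphXn; apply/eqP; congr (_%:C); ring.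
Qed.

(** Converse of [E_neq0_gap]: if column [k] of [E i j] were zero, the norm identity would equate a
    sum of squares with [- gap i j ^+ 2]. *)
Lemma E_exists i j k : i != j -> gap i k = gap i j + gap j k ->
  exists m, E i j m k != 0.
Proof.
move=> ij g; apply/existsP; rewrite -[X in is_true X]negbK negb_exists.
apply/negP => /forallP z.
have := E_col_norm k ij; rewrite g [X in _ - X]big1 => [|m _]; last first.
  by have := z m; rewrite negbK => /eqP ->; rewrite normr0 expr0n.
rewrite subr0 => h; have : 0 <= (gap i j * (gap j k - (gap i j + gap j k)))%:C.
  by rewrite -h sumr_ge0 // => m _; rewrite exprn_ge0.
by rewrite ler0c; have := gap_gt0 ij; nra.
Qed.

Lemma E_gap_const a : (forall i j, i != j -> gap i j = a) ->
  forall i j, E i j = a%:C *: delta_mx i j + ((i == j)%:R * (c - a)%:C)%:M.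
Proof.
move=> ga i j; apply/matrixP => m k; rewrite !mxE.
have [<- | ij] := eqVneq i j.
  have [<- | mk] := eqVneq m k; last first.
    rewrite E_diag //; have [mi|] := eqVneq m i; rewrite ?mulr0 ?addr0 //.
    by rewrite -mi [k == m]eq_sym (negPf mk) mulr0.
  rewrite E_wt mul1r mulr1n; have [-> | mi] := eqVneq m i.
    by rewrite wt_diag mulr1 -rmorphD /= addrC subrK.
  by rewrite mulr0 add0r; have := ga i m; rewrite eq_sym mi /gap => <- //;
    rewrite opprB addrC subrK.
rewrite mul0r mul0rn addr0; have [-> | kj] := eqVneq k j.
  by rewrite E_col // ga // andbT mulrC.
rewrite andbF mulr0; apply/eqP/negPn/negP => /(E_neq0_gap ij).
have := gap_gt0 ij; rewrite (ga i j) // (ga j k) 1?eq_sym //.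
by have [<- | ik] := eqVneq i k; [rewrite gap_diag | rewrite ga //]; lra.
Qed.

(** * Triangles of weights *)

(** The trichotomy for the third point [k] leaves either equal sides at [k] or a second right angle,
    which positive gaps exclude. *)
Lemma gap_right i j k : i != j -> i != k -> k != j ->
  gap i j = gap i k + gap k j -> gap i k = gap k j.
Proof.
move=> ij ik kj g; have := gap_gt0 ij; have := gap_gt0 ik; have := gap_gt0 kj.
by rewrite [gap k j]gap_sym in g *; case: (gap_trichotomy k ij); lra.
Qed.

Lemma gap_triple i j k : i != j -> i != k -> k != j ->
  [\/ gap i k = gap i j /\ gap j k = gap i j,
      gap i k = gap i j /\ gap j k = 2 * gap i j,
      gap i k = 2 * gap i j /\ gap j k = gap i j |
      gap i j = 2 * gap i k /\ gap j k = gap i k].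
Proof.
move=> ij ik kj; have ji : j != i by rewrite eq_sym.
have ki : k != i by rewrite eq_sym.
have jk : j != k by rewrite eq_sym.
have := gap_gt0 ij; have := gap_gt0 ik; have := gap_gt0 kj => pkj pik pij.
have := gap_sym k j; have := gap_sym j i; have := gap_sym k i => ski sji skj.
case: (gap_trichotomy k ij) => e.
- case: (gap_trichotomy j ik) => f; [| |by lra].
    by apply: Or41; split; lra.
  by apply: Or44; split; lra.
- by have := gap_right ik ij jk e => f; apply: Or43; split; lra.
- have e' : gap j k = gap j i + gap i k by lra.
  by have := gap_right jk ji ik e' => f; apply: Or42; split; lra.
Qed.

(** By [gap_triple] a triangle that is not equilateral is right isosceles, which is the second
    alternative. If none occurs, any two gaps are compared through triangles with a common vertex.
    For [d = 2] there is a single gap, so su(2), which is also sp(1), falls in the first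
    alternative. *)
Lemma gap_const_or_double :
  (exists a, forall i j, i != j -> gap i j = a) \/
  exists i j k, [/\ i != j, i != k, j != k, gap i k = gap j k & gap i j = 2 * gap i k].
Proof.
pose bad (p : 'I_d * 'I_d * 'I_d) := let: (i, j, k) := p in
  [&& i != j, i != k, j != k, gap i k == gap j k & gap i j == 2 * gap i k].
have [/existsP[[[i j] k] /and5P[ij ik jk /eqP e /eqP f]] | ] := boolP [exists p, bad p].
  by right; exists i, j, k.
rewrite negb_exists => /forallP nb; left.
have nobad i j k : i != j -> i != k -> j != k -> gap i k = gap j k ->
    gap i j = 2 * gap i k -> False.
  move=> ij ik jk e f; have := nb (i, j, k).
  by rewrite /bad ij ik jk -e f !eqxx.
have tri i j k : i != j -> i != k -> j != k -> gap i j = gap j k.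
  move=> ij ik jk; have kj : k != j by rewrite eq_sym.
  have ki : k != i by rewrite eq_sym.
  have ji : j != i by rewrite eq_sym.
  have := gap_sym k j; have := gap_sym j i; have := gap_sym k i => ski sji skj.
  case: (gap_triple ij ik kj) => -[e f] //.
  - by exfalso; apply: (nobad j k i) => //; lra.
  - by exfalso; apply: (nobad i j k) => //; lra.
have [/existsP[i /existsP[j ij]]|] := boolP [exists i : 'I_d, exists j : 'I_d, i != j].
  exists (gap i j) => p q pq.
  have ji : j != i by rewrite eq_sym.
  have [pi | pi] := eqVneq p i.
    have [qj | qj] := eqVneq q j; first by rewrite pi qj.
    by rewrite pi in pq *; rewrite [RHS]gap_sym; apply/esym/tri; rewrite // eq_sym.
  have [pj | pj] := eqVneq p j.
    have [qi | qi] := eqVneq q i; first by rewrite pj qi gap_sym.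
    by rewrite pj in pq *; apply/esym/tri; rewrite // eq_sym.
  have jp : j != p by rewrite eq_sym.
  rewrite (tri i j p) 1?[i == p]eq_sym //.
  have [qj | qj] := eqVneq q j; first by rewrite qj gap_sym.
  by apply/esym/tri; rewrite // eq_sym.
rewrite negb_exists => /forallP h; exists 0 => i j ij.
by have := h i; rewrite negb_exists => /forallP/(_ j); rewrite ij.
Qed.

(** [k'] is the fourth vertex of the square with diagonal [i], [j]. The angle at [k] is right, so
    [E i k] moves [e_j] to a nonzero vector whose weight is that of [e_i] plus that of [e_j] minus
    that of [e_k]. *)
Lemma gap_mate_ex i j k : i != j -> i != k -> j != k ->
  gap i k = gap j k -> gap i j = 2 * gap i k ->
  exists k', forall n, gap n k' + gap n k = gap n i + gap n j.
Proof.
move=> ij ik jk e f; have [|m nz] := @E_exists i k j ik.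
  by rewrite [gap k j]gap_sym; lra.
by exists m => n; rewrite (gap_weight nz); lra.
Qed.

(* [e_i], [e_j] are the ends of a diagonal of a square whose third vertex is [e_k];
   a further weight [e_n] is equidistant from both ends. *)
Lemma gap_off_mates i j k n : i != j -> i != k -> j != k ->
  gap i k = gap j k -> gap i j = 2 * gap i k -> n != i -> n != j ->
  gap i n = gap i k /\ gap j n = gap i k.
Proof.
move=> ij ik jk e f ni nj; have [-> // | nk] := eqVneq n k.
have [k' kk'] := gap_mate_ex ij ik jk e f.
have jn : j != n by rewrite eq_sym.
have in_ : i != n by rewrite eq_sym.
have p1 := gap_gt0 ij; have p2 := gap_gt0 in_; have p3 := gap_gt0 jn.
have s1 := gap_sym j i.
case: (gap_triple ij in_ nj) => -[x y]; last by split; lra.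
(* If [i], [j], [n] were equilateral, the triangle [i], [k'], [n] would have gaps in the ratio 1, 2,
   3, which is not an allowed shape. *)
- have gkn : gap k n = gap i k.
    by case: (gap_triple ik in_ nk) => -[z w]; lra.
  have := kk' n; rewrite ![gap n _]gap_sym gkn x y f => gk'n.
  have gik' : gap i k' = gap i k by have := kk' i; rewrite gap_diag; lra.
  have ik' : i != k'.
    by apply/negP => /eqP ik'; move: gik'; rewrite -ik' gap_diag; lra.
  have nk' : n != k'.
    by apply/negP => /eqP nk'; move: gk'n; rewrite -nk' gap_diag; lra.
  by case: (gap_triple ik' in_ nk') => -[z w]; lra.
- by case: (gap_triple jk jn nk) => -[z w]; lra.
- by case: (gap_triple ik in_ nk) => -[z w]; lra.
Qed.

Lemma gap_mates i j k : i != j -> i != k -> j != k ->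
  gap i k = gap j k -> gap i j = 2 * gap i k ->
  exists2 mate : 'I_d -> 'I_d,
    forall n p, gap p (mate n) + gap p n = 2 * gap i k &
    forall n p, p != n -> p != mate n -> gap n p = gap i k.
Proof.
move=> ij ik jk e f; set a := gap i k in e f *.
have ji : j != i by rewrite eq_sym.
have off := gap_off_mates ij ik jk e f.
have ijsum p : gap p i + gap p j = 2 * a.
  have [-> | pi] := eqVneq p i; first by rewrite gap_diag f add0r.
  have [-> | pj] := eqVneq p j; first by rewrite gap_diag gap_sym f addr0.
  by have [] := off p pi pj; rewrite ![gap p _]gap_sym -/a; lra.
have /fin_all_exists2[mate m1 m2] : forall n, exists2 n',
    forall p, gap p n' + gap p n = 2 * a & forall p, p != n -> p != n' -> gap n p = a.
  (* For [i] and [j] the mate is the other end of the diagonal; for any other [n] it is the fourth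
     vertex of the square through [n] on that diagonal. *)
  move=> n; have [-> | ni] := eqVneq n i.
    exists j => [p|p pi pj]; last by have [] := off p pi pj.
    by rewrite addrC ijsum.
  have [-> | nj] := eqVneq n j.
    exists i => [p|p pj pi]; last by have [] := off p pi pj.
    by rewrite ijsum.
  have [g1 g2] := off n ni nj; rewrite -/a in g1 g2.
  have in_ : i != n by rewrite eq_sym.
  have jn : j != n by rewrite eq_sym.
  have [||n' nn'] := gap_mate_ex ij in_ jn; [lra|lra|].
  have n'sum p : gap p n' + gap p n = 2 * a by rewrite nn' ijsum.
  exists n' => // p pn pn'.
  have apos : 0 < a by apply: gap_gt0.
  have gnn' : gap n n' = 2 * a by have := n'sum n; rewrite gap_diag addr0.
  have gin' : gap i n' = a by have := n'sum i; rewrite g1; lra.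
  have neq x y : 0 < gap x y -> x != y.
    by move=> h; apply/negP => /eqP exy; move: h; rewrite exy gap_diag ltxx.
  (* The same square, read along its other diagonal [n], [n'] with third vertex [i]. *)
  have [||||r _] := @gap_off_mates n n' i p _ ni _ _ _ pn pn'.
  - by apply: neq; rewrite gnn'; lra.
  - by rewrite eq_sym; apply: neq; rewrite gin'.
  - by rewrite ![gap _ i]gap_sym g1 gin'.
  - by rewrite gnn' [gap n i]gap_sym g1.
  by rewrite r [gap n i]gap_sym g1.
by exists mate.
Qed.

(** * The cross-polytope: antipodal weights and the symplectic form *)

Section Mates.

Variables (a : R) (mate : 'I_d -> 'I_d) (o : 'I_d).
Hypothesis gap_mate_sum : forall n p, gap p (mate n) + gap p n = 2 * a.
Hypothesis gap_off : forall n p, p != n -> p != mate n -> gap n p = a.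
Hypothesis a_gt0 : 0 < a.

Lemma gap_mate n : gap n (mate n) = 2 * a.
Proof. by rewrite -(gap_mate_sum n n) gap_diag addr0. Qed.

Lemma gap_inj i j : gap i j = 0 -> i = j.
Proof. by move=> g0; apply/eqP/negPn/negP => /gap_gt0; rewrite g0 ltxx. Qed.

Lemma mateK : involutive mate.
Proof.
move=> n; apply/esym/gap_inj; have := gap_mate_sum (mate n) n.
by rewrite gap_mate; lra.
Qed.

Lemma mate_neq n : mate n != n.
Proof.
by apply/negP => /eqP e; have := gap_mate n; rewrite e gap_diag; have := a_gt0; lra.
Qed.

(** Over a pair of mates the gaps from [o] add up to [2 * a]; over all indices they add up to
    [c *+ d], because the weights sum to zero. The equality puts the center of the cross-polytope at
    the origin, so mates carry opposite weights. *)
Lemma c_eq_a : c = a.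
Proof.
have s1 : \sum_k gap o k = c *+ d.
  by rewrite sumrB sum_wt subr0 sumr_const card_ord.
have : \sum_k (gap o (mate k) + gap o k) = (2 * a) *+ d.
  by rewrite (eq_bigr _ (fun k _ => gap_mate_sum k o)) sumr_const card_ord.
have s2 : \sum_k gap o (mate k) = c *+ d.
  by rewrite -s1 [RHS](reindex_inj (inv_inj mateK)).
rewrite big_split /= s1 s2 -mulr2n -mulrnA mulnC mulrnA.
rewrite -[c *+ 2]mulr_natl => /eqP; rewrite -subr_eq0 -mulrnBl mulrn_eq0 -mulrBr.
rewrite mulf_eq0 pnatr_eq0 /= subr_eq0 => /orP[/eqP d0|/eqP //].
by case: (o) => x; rewrite d0.
Qed.

Lemma gap_le i j : gap i j <= 2 * a.
Proof. by rewrite -(gap_mate_sum j i) lerDr gap_ge0. Qed.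

Lemma gap_mate_r i j : gap i (mate j) = 2 * a - gap i j.
Proof. by rewrite -(gap_mate_sum j i) addrK. Qed.

Lemma E_mate_diag i : E i i = c%:C *: (delta_mx i i - delta_mx (mate i) (mate i)).
Proof.
have mi := mate_neq i; apply/matrixP => m k; rewrite !mxE.
have [<- | mk] := eqVneq m k; last first.
  rewrite E_diag //; have [ei|_] := eqVneq m i.
    have [ek|_] := eqVneq k i; first by rewrite ei ek eqxx in mk.
    by rewrite ei [i == _]eq_sym (negPf mi) subrr mulr0.
  have [ei|_] := eqVneq m (mate i); last by rewrite subrr mulr0.
  by rewrite -ei [k == m]eq_sym (negPf mk) subrr mulr0.
rewrite E_wt !andbb; have -> : wt i m = c - gap i m by rewrite /gap; lra.
have [-> | mi'] := eqVneq m i.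
  by rewrite [i == _]eq_sym (negPf mi) gap_diag !subr0 mulr1.
have [-> | mm] := eqVneq m (mate i).
  by rewrite gap_mate c_eq_a sub0r mulrN1 -rmorphN; congr (_%:C); ring.
by rewrite gap_off // c_eq_a !subrr mulr0.
Qed.

Lemma E_mate_pair i : E i (mate i) = (2 * c)%:C *: delta_mx i (mate i).
Proof.
have im : i != mate i by rewrite eq_sym mate_neq.
apply/matrixP => m k; rewrite !mxE; have [-> | km] := eqVneq k (mate i).
  by rewrite E_col // gap_mate c_eq_a andbT mulrC.
rewrite andbF mulr0; apply/eqP/negPn/negP => /(E_neq0_gap im).
have := gap_le i k; have : 0 < gap (mate i) k by rewrite gap_gt0 // eq_sym.
by rewrite gap_mate; lra.
Qed.

Section DistinctPairs.

Variables (i j : 'I_d).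
Hypotheses (ij : i != j) (imj : i != mate j).

Let ji : j != i. Proof. by rewrite eq_sym. Qed.
Let jmi : j != mate i.
Proof. by apply: contraNneq imj => ->; rewrite mateK. Qed.

Lemma E_pair_mate m : E i j m (mate i) != 0 -> m = mate j.
Proof.
move=> nz; apply/esym/gap_inj; rewrite (gap_weight nz) gap_mate_r [gap (mate j) j]gap_sym
  gap_mate.
by ring.
Qed.

(** Away from [k = j], a nonzero entry in column [k] needs a right angle at [j] between [i] and [k],
    and this forces [k = mate i]. *)
Lemma E_pair m k : E i j m k
  = ((m == i) && (k == j))%:R * c%:C
    + ((m == mate j) && (k == mate i))%:R * E i j (mate j) (mate i).
Proof.
have [-> | kj] := eqVneq k j.
  by rewrite E_col // gap_off // c_eq_a (negPf jmi) !andbT andbF mul0r addr0.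
rewrite andbF mul0r add0r; have [-> | kmi] := eqVneq k (mate i).
  rewrite andbT; have [-> | mmj] := eqVneq m (mate j); first by rewrite mul1r.
  rewrite mul0r; apply/eqP/negPn/negP => /E_pair_mate /eqP.
  by rewrite (negPf mmj).
rewrite andbF mul0r; apply/eqP/negPn/negP => /(E_neq0_gap ij).
have : 0 < gap j k by rewrite gap_gt0 // eq_sym.
have -> : gap i j = a by rewrite gap_off.
have [-> | ki] := eqVneq k i; first by rewrite gap_diag; have := a_gt0; lra.
by rewrite (@gap_off i k) //; lra.
Qed.

Lemma E_pair_norm : `|E i j (mate j) (mate i)| = c%:C.
Proof.
have gij : gap i j = a by rewrite gap_off.
have [|m nz] := @E_exists i j (mate i) ij.
  by rewrite gap_mate gap_mate_r [gap j i]gap_sym gij; ring.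
by have e := E_pair_mate nz; rewrite e in nz; rewrite E_neq0_norm // gij c_eq_a.
Qed.

End DistinctPairs.

(** Normalized so that, for [i != j] and [i != mate j], [E i j] is [c] times the matrix unit at
    [(i, j)] minus [phase i j] times the one at [(mate j, mate i)]. *)
Definition phase i j := - (E i j (mate j) (mate i) / c%:C).

(** The sign is the antisymmetry [E_swap]; it makes the resulting invariant form alternating rather
    than symmetric. *)
Lemma phase_mate i j : i != j -> i != mate j -> phase (mate i) j = - phase i j.
Proof.
move=> ij imj; rewrite /phase opprK mateK E_swap ?mulNr ?opprK //.
- by apply: contraNneq imj => <-; rewrite mateK.
Qed.

Lemma phase_conj i j : phase j i = (phase i j)^*%R.
Proof. 
have cc := conjC_real c.
by rewrite /phase [E j i _ _]E_adj rmorphN rmorphM; congr (- (_ * _)); rewrite fmorphV;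
  congr (_^-1); exact: esym.
Qed.

Lemma phase_norm i j : i != j -> i != mate j -> phase i j * (phase i j)^*%R = 1.
Proof.
move=> ij imj; rewrite -[LHS](normCK (phase i j)) normrN normrM normfV.
rewrite E_pair_norm // ger0_norm ?ler0c ?ltW ?c_gt0 //.
by rewrite divff ?expr1n // cC_neq0.
Qed.

(** Cocycle relation, read off the entry [(mate k, mate i)] of [[E i j, E j k]], which equals [c]
    times [E i k]. *)
Lemma phase_mul i j k : i != j -> i != mate j -> j != k -> j != mate k ->
  i != k -> i != mate k -> phase i k = phase i j * phase j k.
Proof.
move=> ij imj jk jmk ik imk.
have c0 := cC_neq0.
have /(congr1 (fun A : 'M_d => A (mate k) (mate i))) := E_comm i j j k.
have -> : \sum_m E i j m j *: E m k = c%:C *: E i k.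
  rewrite (bigD1 i) //= E_col // eqxx mul1r big1 ?addr0 => [|m mi0].
    by rewrite gap_sym gap_off // c_eq_a.
  by rewrite E_col // (negPf mi0) mul0r scale0r.
have -> : \sum_m E i j k m *: E j m = 0.
  rewrite big1 // => m _; rewrite E_pair // [k == i]eq_sym (negPf ik).
  have -> : k == mate j = false.
    by apply/negP => /eqP ek; move: jmk; rewrite ek mateK eqxx.
  by rewrite !mul0r addr0 scale0r.
have mki : mate k != i by apply: contraNneq imk => <-.
have mkj : mate k != j by rewrite eq_sym.
rewrite subr0 sub_mxE [(E i j *m _) _ _]mxE big1 => [|m _]; last first.
  by rewrite [E i j _ _]E_pair // (negPf mki) (inj_eq (inv_inj mateK)) [k == j]eq_sym
    (negPf jk) !mul0r addr0 mul0r.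
rewrite [(E j k *m _) _ _]mxE (bigD1 (mate j)) //= big1 => [|m mj]; last first.
  by rewrite [E j k _ _]E_pair // (negPf mkj) (negPf mj) andbF !mul0r addr0 mul0r.
rewrite addr0 sub0r !mxE /phase => h; apply: (mulfI c0).
rewrite mulrN [c%:C * _]mulrC divfK // mulrNN.
apply: (mulfI c0); rewrite mulrN -h opprK.
by field.
Qed.

(** Trivializes the cocycle [phase] from the base point [o]. At [mate o] the entry behind [phase]
    belongs to a long root and is twice as large, so the values at [o] and [mate o] are set by hand,
    with opposite signs as for all mates. *)
Definition sgn_phase p := if p == o then 1 else if p == mate o then -1 else phase p o.

Lemma sgn_phase_mate p : sgn_phase (mate p) = - sgn_phase p.
Proof.
rewrite /sgn_phase (inj_eq (inv_inj mateK)).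
have [-> | po] := eqVneq p o; first by rewrite (negPf (mate_neq o)).
have -> : (mate p == o) = (p == mate o) by rewrite (inv_eq mateK).
have [_ | pmo] := eqVneq p (mate o); first by rewrite opprK.
by rewrite phase_mate.
Qed.

Lemma sgn_phase_norm p : sgn_phase p * (sgn_phase p)^*%R = 1.
Proof.
rewrite /sgn_phase; have [_|po] := eqVneq p o; first by rewrite rmorph1 mulr1.
have [_|pmo] := eqVneq p (mate o); first by rewrite rmorphN1 mulrNN mulr1.
exact: phase_norm.
Qed.

Lemma sgn_phaseE i j : i != j -> i != mate j ->
  phase i j = sgn_phase i * (sgn_phase j)^*%R.
Proof.
move=> ij imj; have ji : j != i by rewrite eq_sym.
have jmi : j != mate i by apply: contraNneq imj => ->; rewrite mateK.
rewrite {1}/sgn_phase; have [io|io] := eqVneq i o.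
  rewrite mul1r /sgn_phase -io (negPf ji) (negPf jmi).
  by rewrite [phase j i]phase_conj conjCK.
have [imo|imo] := eqVneq i (mate o).
  rewrite mulN1r /sgn_phase.
  have oi : o = mate i by rewrite imo mateK.
  rewrite oi (negPf jmi) mateK (negPf ji) [phase j _]phase_conj conjCK.
  by rewrite phase_mate // opprK.
rewrite /sgn_phase; have [jo|jo] := eqVneq j o; first by rewrite jo rmorph1 mulr1.
have [jmo|jmo] := eqVneq j (mate o).
  have oi : o != i by rewrite eq_sym.
  have omi : o != mate i by apply: contraNneq imo => ->; rewrite mateK.
  rewrite rmorphN1 mulrN1 jmo phase_conj (phase_mate oi omi).
  by rewrite rmorphN [phase i o]phase_conj.
by rewrite (@phase_mul i j o) // -mulrA phase_norm // mulr1.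
Qed.

Lemma E_symp i j : E i j = c%:C *: (delta_mx i j
  - (sgn_phase i * (sgn_phase j)^*%R) *: delta_mx (mate j) (mate i)).
Proof.
have [-> | ij] := eqVneq i j.
  by rewrite E_mate_diag sgn_phase_norm scale1r.
have [-> | imj] := eqVneq i (mate j).
  have := E_mate_pair (mate j); rewrite mateK => ->.
  rewrite sgn_phase_mate mulNr sgn_phase_norm scaleN1r opprK -mulr2n.
  by rewrite -scaler_nat scalerA; congr (_ *: _); rewrite rmorphM rmorph_nat mulrC.
apply/matrixP => m k; rewrite E_pair // -sgn_phaseE // !mxE /phase.
have c0 := cC_neq0.
by field.
Qed.

End Mates.

Theorem split_casimir_dichotomy :
  (exists a, 0 < a /\
     forall i j, E i j = a%:C *: delta_mx i j + ((i == j)%:R * (c - a)%:C)%:M)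
  \/ 0 < c /\ exists (mate : 'I_d -> 'I_d) (s : 'I_d -> R[i]),
     [/\ involutive mate, forall i, mate i != i,
         forall i, s (mate i) = - s i, forall i, s i * (s i)^*%R = 1 &
         forall i j, E i j = c%:C *: (delta_mx i j
           - (s i * (s j)^*%R) *: delta_mx (mate j) (mate i))].
Proof.
have [[a ga]|] := gap_const_or_double.
  left; have [/existsP[i /existsP[j ij]]|] := boolP [exists i : 'I_d, exists j : 'I_d, i != j].
    exists a; split; last exact: E_gap_const.
    by rewrite -(ga i j) ?gap_gt0.
  (* Here [1] is a placeholder: with at most one index, the traceless [E i0 j0] would be zero. *)
  rewrite negb_exists => /forallP h; exists 1; split => //.
  exfalso; have [i0 [j0 /eqP[]]] := E_neq0.
  have all1 (i j : 'I_d) : i = j.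
    by have := h i; rewrite negb_exists => /forallP/(_ j); rewrite negbK => /eqP.
  have := E_tr0 i0 j0; rewrite /mxtrace (bigD1 i0) //= big1 => [|k]; last first.
    by rewrite (all1 k i0) eqxx.
  by rewrite addr0 => e; apply/matrixP => x y; rewrite mxE (all1 x i0) (all1 y i0).
move=> [i [j [k [ij ik jk e f]]]]; right.
have [mate m1 m2] := gap_mates ij ik jk e f.
have apos : 0 < gap i k by apply: gap_gt0.
split; first exact: c_gt0.
exists mate, (sgn_phase mate i); split.
- exact: mateK m1.
- exact: mate_neq m1 apos.
- exact: sgn_phase_mate m1 apos.
- exact: sgn_phase_norm m1 m2.
- exact: E_symp m1 m2 apos.
Qed.

End SplitCasimirTensor.

(** * The Casimir map of a family of matrices *)

Lemma tr_delta_mul (K : pzRingType) n (A : 'M[K]_n) i j : \tr (delta_mx i j *m A) = A j i.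
Proof.
rewrite /mxtrace (bigD1 i) //= big1 => [|q qi].
  rewrite addr0 mxE (bigD1 j) //= big1 ?addr0 => [|q qj].
    by rewrite mxE !eqxx mul1r.
  by rewrite mxE (negPf qj) andbF mul0r.
by rewrite mxE big1 // => r _; rewrite mxE (negPf qi) mul0r.
Qed.

Section Adjoint.
Variable C : numClosedFieldType.

Lemma adjM m n p (A : 'M[C]_(m, n)) (B : 'M[C]_(n, p)) :
  (A *m B)^t* = B^t* *m A^t*.
Proof. by rewrite trmx_mul map_mxM. Qed.

Lemma adjB m n (A B : 'M[C]_(m, n)) : (A - B)^t* = A^t* - B^t*.
Proof. by rewrite linearB map_mxB. Qed.

Lemma adjD m n (A B : 'M[C]_(m, n)) : (A + B)^t* = A^t* + B^t*.
Proof. by rewrite linearD map_mxD. Qed.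

Lemma adjN m n (A : 'M[C]_(m, n)) : (- A)^t* = - A^t*.
Proof. by rewrite linearN map_mxN. Qed.

Lemma adjZ m n a (A : 'M[C]_(m, n)) : (a *: A)^t* = a^*%R *: A^t*.
Proof. by rewrite linearZ map_mxZ. Qed.

Lemma adj_sum m n (I : finType) (F : I -> 'M[C]_(m, n)) :
  (\sum_i F i)^t* = \sum_i (F i)^t*.
Proof. by rewrite linear_sum map_mx_sum. Qed.

Lemma adj_delta m n (i : 'I_m) (j : 'I_n) : (delta_mx i j : 'M[C]_(m, n))^t* = delta_mx j i.
Proof. by rewrite trmx_delta map_delta_mx. Qed.

Lemma tr_adj n (A : 'M[C]_n) : \tr (A^t*) = (\tr A)^*%R.
Proof. by rewrite /mxtrace rmorph_sum; apply: eq_bigr => i _; rewrite !mxE. Qed.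

Lemma trmul_adj m n (A : 'M[C]_(m, n)) : \tr (A *m A^t*) = \sum_i \sum_j `|A i j| ^+ 2.
Proof.
apply: eq_bigr => i _; rewrite mxE; apply: eq_bigr => j _.
by rewrite !mxE normCK.
Qed.

Lemma trmul_adj_ge0 m n (A : 'M[C]_(m, n)) : 0 <= \tr (A *m A^t*).
Proof.
by rewrite trmul_adj sumr_ge0 // => i _; rewrite sumr_ge0 // => j _; rewrite exprn_ge0.
Qed.

Lemma trmul_adj_eq0 m n (A : 'M[C]_(m, n)) : \tr (A *m A^t*) = 0 -> A = 0.
Proof.
move/eqP; rewrite trmul_adj psumr_eq0 => [/allP h|i _]; last first.
  by rewrite sumr_ge0 // => j _; rewrite exprn_ge0.
apply/matrixP => i j; rewrite mxE; have := h i (mem_index_enum _).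
rewrite psumr_eq0 => [/allP/(_ j (mem_index_enum _))|k _]; last by rewrite exprn_ge0.
by rewrite expf_eq0 /= normr_eq0 => /eqP.
Qed.

End Adjoint.

HB.lock Definition cas (R : rcfType) (n d : nat) (X : 'I_n -> 'M[R[i]]_d)
  (A : 'M[R[i]]_d) : 'M[R[i]]_d := - \sum_i \tr (A *m X i) *: X i.

Section Casimir.

Variables (R : rcfType) (n d : nat).
Local Notation C := R[i].
Implicit Types X : 'I_n -> 'M[C]_d.

Lemma casE X A : cas X A = - \sum_i \tr (A *m X i) *: X i.
Proof. by rewrite unlock. Qed.

Lemma cas_is_linear X : linear (cas X).
Proof.
move=> a A B; rewrite !casE scalerN -opprD scaler_sumr -big_split /=.
congr (- _); apply: eq_bigr => i _.
by rewrite mulmxDl -scalemxAl mxtraceD mxtraceZ scalerDl scalerA.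
Qed.

HB.instance Definition _ X := GRing.isLinear.Build _ _ _ _ (cas X) (cas_is_linear X).

Lemma cas_conj X (U : 'M[C]_d) : U \is unitarymx -> forall A,
  cas (fun i => U *m X i *m U^t*) A = U *m cas X (U^t* *m A *m U) *m U^t*.
Proof.
move=> Uu A; rewrite !casE mulmxN mulNmx mulmx_sumr mulmx_suml; congr (- _).
apply: eq_bigr => i _; rewrite -scalemxAr -scalemxAl; congr (_ *: _).
by rewrite !mulmxA mxtrace_mulC !mulmxA.
Qed.

Variable X : 'I_n -> 'M[C]_d.
Hypothesis X_skew : forall i, (X i)^t* = - X i.
Hypothesis X_inv : forall i A,
  cas X (X i *m A - A *m X i) = X i *m cas X A - cas X A *m X i.

Lemma cas_adj A : (cas X A)^t* = cas X (A^t*).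
Proof.
rewrite !casE adjN adj_sum; congr (- _); apply: eq_bigr => i _.
rewrite adjZ X_skew scalerN -scaleNr -tr_adj adjM X_skew mulNmx mxtrace_mulC.
by rewrite linearN /= opprK.
Qed.

Definition cas_equiv H :=
  forall A, cas X (H *m A - A *m H) = H *m cas X A - cas X A *m H.

Lemma cas_equiv_cas B : cas_equiv (cas X B).
Proof.
move=> A; have -> : cas X B = \sum_i (- \tr (B *m X i)) *: X i.
  by rewrite !casE -sumrN; apply: eq_bigr => i _; rewrite scaleNr.
rewrite !mulmx_suml !mulmx_sumr -!sumrB linear_sum /=; apply: eq_bigr => i _.
by rewrite -!scalemxAl -!scalemxAr -!scalerBr linearZ /= X_inv.
Qed.

Let good (A : 'M[C]_d) := A^t* = A /\ cas_equiv A.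

(** A Hermitian matrix that is triangular in an orthonormal basis is diagonal there, so the family
    has an orthonormal eigenbasis. The coordinate projections of that basis commute with the family,
    hence by equivariance so do their images under [cas]. An image that is not diagonal lies outside
    the span of the family and extends it. *)
Lemma cas_diagonalize_or_extend (As : seq 'M[C]_d) :
  (forall A, A \in As -> good A) -> {in As &, forall A B, comm_mx A B} ->
  (exists2 U : 'M[C]_d, U \is unitarymx &
    forall i, is_diag_mx (U *m cas X (U^t* *m delta_mx i i *m U) *m U^t*))
  \/ exists H, [/\ good H, forall A, A \in As -> comm_mx A H & H \notin <<As>>%VS].
Proof.
move=> As_good As_comm.
have [U Uu /allP Utrig] := cotrigonalization As_comm.
have UV : U^t* *m U = 1%:M by apply: mulmx1C; apply/unitarymxP.
have UU : U *m U^t* = 1%:M by apply/unitarymxP.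
have As_diag A : A \in As -> is_diag_mx (U *m A *m U^t*).
  move=> AAs; apply/is_diag_mxP => i j; have [Aherm _] := As_good A AAs.
  have /is_trig_mxP trig := Utrig A AAs.
  have herm p q : (U *m A *m U^t*) p q = ((U *m A *m U^t*) q p)^*%R.
    by rewrite -[in LHS]Aherm -[X in X *m _ *m _]trmxCK -!adjM mulmxA !mxE.
  by rewrite neq_ltn => /orP[ij|ji]; [|rewrite herm];
    rewrite -conjymx // trig ?conjC0.
pose h i := cas X (U^t* *m delta_mx i i *m U).
have [/forallP ?|] := boolP [forall i, is_diag_mx (U *m h i *m U^t*)].
  by left; exists U.
rewrite negb_forall => /existsP[i hi]; right; exists (h i); split.
- split; last exact: cas_equiv_cas.
  by rewrite /h cas_adj !adjM adj_delta trmxCK mulmxA.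
- move=> A AAs; have [_ Aeq] := As_good A AAs.
  apply/eqP; rewrite -subr_eq0 -Aeq.
  have -> : A = U^t* *m (U *m A *m U^t*) *m U.
    by rewrite !mulmxA UV mul1mx -mulmxA UV mulmx1.
  have /diag_mxP[D ->] := As_diag A AAs.
  have conj (P Q : 'M[C]_d) :
      U^t* *m P *m U *m (U^t* *m Q *m U) = U^t* *m (P *m Q) *m U.
    by rewrite -!mulmxA [X in _ *m (_ *m X)]mulmxA UU mul1mx.
  rewrite !conj.
  have -> : diag_mx D *m delta_mx i i = delta_mx i i *m diag_mx D.
    by apply/matrixP => p q; rewrite mul_diag_mx mul_mx_diag !mxE mulrC;
      case: eqP => [->|]; case: eqP => [->|]; rewrite ?mul0r.
  by rewrite subrr linear0.
- apply: contra hi => hs; have hs' : h i \in <<in_tuple As>>%VS by [].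
  rewrite (coord_span hs'); apply/is_diag_mxP => p q pq;
    rewrite mulmx_sumr mulmx_suml summxE big1 // => k _.
  rewrite -scalemxAr -scalemxAl mxE.
  have /As_diag/is_diag_mxP/(_ _ _ pq) -> : (in_tuple As)`_k \in As by apply: mem_nth.
  by rewrite mulr0.
Qed.

(* Grow a linearly independent commuting family of Hermitian matrices for which
   [cas X] is equivariant; once it is maximal, the common eigenbasis works. *)
Lemma cas_diagonalize : exists2 U : 'M[C]_d, U \is unitarymx &
  forall i, is_diag_mx (U *m cas X (U^t* *m delta_mx i i *m U) *m U^t*).
Proof.
(* [k] bounds the codimension of the span of [As]. *)
suff step k (As : seq 'M[C]_d) : (forall A, A \in As -> good A) ->
    {in As &, forall A B, comm_mx A B} -> free As ->
    (\dim (fullv : {vspace 'M[C]_d}) <= size As + k)%N ->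
    exists2 U : 'M[C]_d, U \is unitarymx &
      forall i, is_diag_mx (U *m cas X (U^t* *m delta_mx i i *m U) *m U^t*).
  by apply: (step _ [::]) => //; [exact: nil_free | exact: leqnn].
elim: k As => [|k IH] As gAs cAs fAs sAs;
  have [//|[H [gH cH nH]]] := cas_diagonalize_or_extend gAs cAs.
  case/negP: nH; suff -> : <<As>>%VS = fullv by rewrite memvf.
  apply/eqP; rewrite eqEdim subvf /=; move: fAs sAs; rewrite /free addn0.
  by move/eqP->.
apply: (IH (H :: As)).
- by move=> A; rewrite inE => /orP[/eqP-> | /gAs].
- move=> A B; rewrite !inE => /orP[/eqP->|Ai] /orP[/eqP->|Bi] //.
  + by apply/comm_mx_sym/cH.
  + exact: cH.
  + exact: cAs.
- by rewrite free_cons nH.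
- by rewrite /= addSnnS.
Qed.

End Casimir.

Lemma mul_deltaE (K : pzRingType) m n p q (A : 'M[K]_(m, n)) (B : 'M[K]_(p, q)) i k j l :
  (A *m delta_mx i k *m B) j l = A j i * B k l.
Proof.
by rewrite -(mul_delta_mx (0 : 'I_1)) mulmxA -colE -mulmxA -rowE mxE big_ord1 !mxE.
Qed.

Section SkewFamily.

Variables (R : rcfType) (n d : nat).
Local Notation C := R[i].

(** On symmetric matrices, [S |-> X S X^T] is the action of [X (x) X]; the fourth clause is thus the
    scalar action of the split Casimir tensor on Sym^2 V. *)
Definition casimir_family (c' : C) (X : 'I_n -> 'M[C]_d) :=
  [/\ forall i, (X i)^t* = - X i,
      forall i A, cas X (X i *m A - A *m X i) = X i *m cas X A - cas X A *m X i,
      forall i, \tr (X i) = 0,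
      forall S : 'M[C]_d, S^T = S -> \sum_i X i *m S *m (X i)^T = c' *: S &
      exists i, X i != 0].

Lemma casimir_family_conj c' X (U : 'M[C]_d) : U \is unitarymx ->
  casimir_family c' X -> casimir_family c' (fun i => U *m X i *m U^t*).
Proof.
move=> Uu [sk inv tr0 sym [p Xp]].
have [V VE] : exists V, V = U^t* by exists (U^t*).
have UU : U *m V = 1%:M by rewrite VE; apply/unitarymxP.
have VU : V *m U = 1%:M by apply: mulmx1C.
have VA : V^t* = U by rewrite VE trmxCK.
have casV A : cas (fun i => U *m X i *m U^t*) A = U *m cas X (V *m A *m U) *m V.
  by rewrite VE cas_conj.
rewrite -VE in casV *.
split.
- by move=> i; rewrite !adjM VA -VE sk mulNmx mulmxN mulmxA.
- move=> i A; rewrite !casV mulmxBr mulmxBl.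
  have e1 : V *m (U *m X i *m V *m A) *m U = X i *m (V *m A *m U).
    by rewrite -!mulmxA mulmxA VU mul1mx.
  have e2 : V *m (A *m (U *m X i *m V)) *m U = (V *m A *m U) *m X i.
    by rewrite !mulmxA -[_ *m V *m U]mulmxA VU mulmx1.
  rewrite e1 e2 inv mulmxBr mulmxBl; congr (_ - _).
    rewrite !mulmxA; congr (_ *m _ *m _).
    by rewrite -[_ *m V *m U]mulmxA VU mulmx1.
  by rewrite -!mulmxA [V *m (U *m _)]mulmxA VU mul1mx.
- by move=> i; rewrite mxtrace_mulC mulmxA VU mul1mx tr0.
- move=> S S_sym.
  have Sy : V *m S *m (V)^T = (V *m S *m (V)^T)^T.
    by rewrite !trmx_mul trmxK S_sym mulmxA.
  have WW : V^T *m U^T = 1%:M by rewrite -trmx_mul UU trmx1.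
  transitivity (U *m (c' *: (V *m S *m V^T)) *m U^T); last first.
    rewrite -scalemxAr -scalemxAl; congr (_ *: _).
    by rewrite -!mulmxA WW mulmx1 mulmxA UU mul1mx.
  rewrite -(sym _ (esym Sy)) mulmx_sumr mulmx_suml.
  by apply: eq_bigr => i _; rewrite !trmx_mul !mulmxA.
- exists p; apply: contraNneq Xp => e0.
  suff <- : V *m (U *m X p *m V) *m U = X p by rewrite e0 mulmx0 mul0mx.
  by rewrite !mulmxA VU mul1mx -mulmxA VU mulmx1.
Qed.

Variables (c' : C) (X : 'I_n -> 'M[C]_d).
Hypothesis X_fam : casimir_family c' X.

Lemma cas_deltaE i j m k : cas X (delta_mx i j) m k = - \sum_p X p j i * X p m k.
Proof.
rewrite casE !mxE summxE; congr (- _); apply: eq_bigr => p _.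
by rewrite mxE tr_delta_mul.
Qed.

Lemma cas_trace A : \tr (cas X A) = 0.
Proof.
have [_ _ tr0 _ _] := X_fam.
rewrite casE (raddfN (@mxtrace C d)) (raddf_sum (@mxtrace C d)) big1 ?oppr0 //= => i _.
by rewrite mxtraceZ tr0 mulr0.
Qed.

Lemma family_entry_conj p i j : X p i j = - (X p j i)^*%R.
Proof.
by have [/(_ p)/matrixP/(_ i j)] := X_fam; rewrite !mxE => ->; rewrite opprK.
Qed.

Lemma cas_delta_sq i j : cas X (delta_mx i j) i j = \sum_p `|X p j i| ^+ 2.
Proof.
rewrite cas_deltaE -sumrN; apply: eq_bigr => p _.
by rewrite [X p i j]family_entry_conj mulrN opprK normCK.
Qed.

(** The scalar identity for [S = e_ik + e_ki], read at the entry [(j, m)]. *)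
Lemma cas_sym2 i j k m :
  cas X (delta_mx i j) m k + cas X (delta_mx k j) m i
  = - c' * ((i == j)%:R * (m == k)%:R + (j == k)%:R * (m == i)%:R).
Proof.
have [_ _ _ sym _] := X_fam.
rewrite !cas_deltaE mulNr -[LHS]opprD; congr (- _).
have Ssym : (delta_mx i k + delta_mx k i : 'M[C]_d)^T = delta_mx i k + delta_mx k i.
  by rewrite linearD /= !trmx_delta addrC.
have /matrixP/(_ j m) := sym _ Ssym; rewrite summxE !mxE [i == j]eq_sym -!natrM !mulnb => <-.
rewrite -big_split /=; apply: eq_bigr => p _.
by rewrite mulmxDr mulmxDl mxE !mul_deltaE !mxE.
Qed.

Lemma cas_delta_eq0 i j : cas X (delta_mx i j) i j = 0 -> forall p, X p j i = 0.
Proof.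
rewrite cas_delta_sq => /eqP; rewrite psumr_eq0 => [/allP h p|p _]; last first.
  by rewrite exprn_ge0.
by have := h p (mem_index_enum _); rewrite expf_eq0 /= normr_eq0 => /eqP.
Qed.

Lemma family_dichotomy : (forall i, is_diag_mx (cas X (delta_mx i i))) ->
  (exists a e : R, 0 < a /\
     forall i j, cas X (delta_mx i j) = a%:C *: delta_mx i j + ((i == j)%:R * e%:C)%:M)
  \/ exists2 c : R, 0 < c & exists (mate : 'I_d -> 'I_d) (s : 'I_d -> R[i]),
     [/\ involutive mate, forall i, mate i != i,
         forall i, s (mate i) = - s i, forall i, s i * (s i)^*%R = 1 &
         forall i j, cas X (delta_mx i j) = c%:C *: (delta_mx i j
           - (s i * (s j)^*%R) *: delta_mx (mate j) (mate i))].
Proof.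
move=> diag; have [_ inv _ _ [p Xp]] := X_fam.
have [j0 [i0 Xij]] : exists j i, X p j i != 0 by apply/matrix0Pn.
(* [c'] is a priori a complex number; this instance of the symmetric relation exhibits [- c'] as a
   sum of squares, hence as a nonnegative real. *)
have c'E : - c' = cas X (delta_mx i0 i0) i0 i0.
  have := cas_sym2 i0 i0 i0 i0; rewrite !eqxx !mulr1 => h.
  apply: (@mulIf _ 2%:R); first by rewrite pnatr_eq0.
  by rewrite -[2%:R]/(1 + 1) -h mulrDr mulr1.
have c'_ge0 : 0 <= - c'.
  by rewrite c'E cas_delta_sq sumr_ge0 // => q _; rewrite exprn_ge0.
pose c : R := complex.Re (- c').
have cE : c%:C = - c' by apply/RRe_real/ger0_real.
have := @split_casimir_dichotomy R d c (fun i j => cas X (delta_mx i j)).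
case.
- by rewrite -ler0c cE.
- by move=> i k m km; move/is_diag_mxP: (diag i); apply.
- by move=> i j k m; rewrite cE cas_sym2.
- by move=> i j m k; rewrite !cas_deltaE; congr (- _); apply: eq_bigr => q _; rewrite mulrC.
- move=> i j m k; rewrite !cas_deltaE rmorphN rmorph_sum; congr (- _).
  apply: eq_bigr => q _; rewrite rmorphM /=.
  by rewrite [X q i j]family_entry_conj [X q k m]family_entry_conj mulrNN.
- move=> i j k l; rewrite -(cas_equiv_cas inv); rewrite linearB /=.
  have -> : cas X (delta_mx i j) *m delta_mx k l
      = \sum_m cas X (delta_mx i j) m k *: delta_mx m l.
    apply/matrixP => x y; rewrite summxE (bigD1 x) //= big1 => [|z zx].
      rewrite addr0 !mxE (bigD1 k) //= big1 => [|z zk]; last first.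
        by rewrite !mxE (negPf zk) mulr0.
      by rewrite !mxE !eqxx addr0.
    by rewrite !mxE eq_sym (negPf zx) mulr0.
  have -> : delta_mx k l *m cas X (delta_mx i j)
      = \sum_m cas X (delta_mx i j) l m *: delta_mx k m.
    apply/matrixP => x y; rewrite summxE (bigD1 y) //= big1 => [|z zx].
      rewrite addr0 !mxE (bigD1 l) //= big1 => [|z zk]; last first.
        by rewrite !mxE (negPf zk) andbF mul0r.
      by rewrite !mxE !eqxx andbT addr0 mulrC.
    by rewrite !mxE [y == z]eq_sym (negPf zx) andbF mulr0.
  by congr (_ - _); rewrite (linear_sum (cas X)); apply: eq_bigr => m _; rewrite linearZ.
- by move=> i j; rewrite cas_trace.
- by move=> i j; rewrite cas_delta_sq sumr_ge0 // => q _; rewrite exprn_ge0.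
- move=> i j e0; apply/matrixP => m k; rewrite cas_deltaE mxE big1 ?oppr0 // => q _.
  by rewrite (cas_delta_eq0 e0) mul0r.
- move=> i j; rewrite !cas_deltaE => h.
  (* This is the squared distance of the weights of [e_i] and [e_j]; as the diagonal entries are
     imaginary, it expands into the four terms of the hypothesis. *)
  have : \sum_q `|X q i i - X q j j| ^+ 2 = 0.
    move/eqP: h; rewrite -!opprD eqr_opp -!big_split /= -subr_eq0 -sumrB => /eqP h.
    rewrite -[RHS]oppr0 -[in RHS]h -sumrN; apply: eq_bigr => q _.
    have cj k : (X q k k)^*%R = - X q k k by rewrite {2}family_entry_conj opprK.
    by rewrite normCK rmorphB /= !cj; ring.
  move/eqP; rewrite psumr_eq0 => [/allP h2|q _]; last by rewrite exprn_ge0.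
  apply/matrixP => m k; rewrite !cas_deltaE; congr (- _); apply: eq_bigr => q _.
  have := h2 q (mem_index_enum _); rewrite expf_eq0 /= normr_eq0 subr_eq0.
  by move/eqP => ->.
- exists i0, j0; apply: contraNneq Xij => e0; apply/eqP.
  by apply: cas_delta_eq0; rewrite e0 mxE.
- by move=> [a [a0 h]]; left; exists a, (c - a).
- by move=> [c0 h]; right; exists c.
Qed.

End SkewFamily.

(** * Recognizing su and sp *)

(** The smaller index of each pair goes to the first half of the numbering and its mate to the same
    place in the second half, as in the block layout of [sympJ]. *)
Lemma mate_enum d (mate : 'I_d -> 'I_d) : involutive mate -> (forall i, mate i != i) ->
  exists l (f : 'I_(l + l) -> 'I_d),
    [/\ d = (l + l)%N, injective f & forall k, f (rshift l k) = mate (f (lshift l k))].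
Proof.
move=> mateK mate_neq; pose A := [set i : 'I_d | (i < mate i)%N].
have mA i : (mate i \in A) = (i \notin A).
  rewrite !inE mateK -leqNgt [RHS]leq_eqVlt.
  by have -> : (mate i == i :> nat) = false by exact: negPf (mate_neq i).
have AC : ~: A = mate @: A.
  apply/setP => i; rewrite inE -mA -[in RHS](mateK i) mem_imset //.
  exact: inv_inj.
pose f (p : 'I_(#|A| + #|A|)) : 'I_d :=
  match split p with inl k => enum_val k | inr k => mate (enum_val k) end.
have fl k : f (lshift _ k) = enum_val k by rewrite /f (unsplitK (inl k)).
have fr k : f (rshift _ k) = mate (enum_val k) by rewrite /f (unsplitK (inr k)).
exists #|A|, f; split; last by move=> k; rewrite fl fr.
  have := cardsC A; rewrite AC card_imset ?card_ord; last exact: inv_inj.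
  by move=> ->.
move=> p q; rewrite -[p]splitK -[q]splitK.
case: (split p) => k; case: (split q) => k' /=; rewrite ?fl ?fr.
- by move/enum_val_inj->.
- by move=> e; have := enum_valP k; rewrite e mA enum_valP.
- by move=> e; have := enum_valP k'; rewrite -e mA enum_valP.
- by move/(inv_inj mateK)/enum_val_inj->.
Qed.

Section RealSpan.

Variables (R : realType) (n d : nat) (c' : R[i]) (X : 'I_n -> 'M[R[i]]_d).
Hypothesis X_fam : casimir_family c' X.

(** The trace of [cas X A] times the adjoint of [A] is the sum of the squared moduli of the numbers
    [\tr (A *m X p)]. *)
Lemma cas_eq0 A : cas X A = 0 -> forall p, \tr (A *m X p) = 0.
Proof.
have [sk _ _ _ _] := X_fam => e0.
have trX p : \tr (X p *m A^t*) = - (\tr (A *m X p))^*%R.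
  by rewrite -tr_adj adjM sk mulNmx linearN opprK.
have : \sum_p `|\tr (A *m X p)| ^+ 2 = 0.
  transitivity (\tr (cas X A *m A^t*)); last by rewrite e0 mul0mx mxtrace0.
  rewrite casE mulNmx mulmx_suml (raddfN (@mxtrace R[i] d)) (raddf_sum (@mxtrace R[i] d))
    -sumrN /=.
  apply: eq_bigr => p _; rewrite -scalemxAl mxtraceZ trX mulrN opprK.
  by rewrite normCK.
move/eqP; rewrite psumr_eq0 => [/allP h p|p _]; last by rewrite exprn_ge0.
by have := h p (mem_index_enum _); rewrite expf_eq0 /= normr_eq0 => /eqP.
Qed.

Lemma real_span_skew (r : 'I_n -> R) :
  (\sum_p (r p)%:C *: X p)^t* = - \sum_p (r p)%:C *: X p.
Proof.
have [sk _ _ _ _] := X_fam.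
rewrite adj_sum -sumrN; apply: eq_bigr => p _.
by rewrite adjZ sk conjC_real scalerN.
Qed.

(** [Z] is [a^-1] times [cas X Z], a combination of the [X p]. Its coefficients are real because the
    trace of a product of two skew-Hermitian matrices is real. *)
Lemma cas_eigen_span Z (a : R) : a != 0 -> Z^t* = - Z -> cas X Z = a%:C *: Z ->
  exists r : 'I_n -> R, \sum_p (r p)%:C *: X p = Z.
Proof.
have [sk _ _ _ _] := X_fam => a0 Zsk casZ.
exists (fun p => - (a^-1 * complex.Re (\tr (Z *m X p)))).
have trR p : (complex.Re (\tr (Z *m X p)))%:C = \tr (Z *m X p).
  apply/RRe_real/CrealP.
  by rewrite -tr_adj adjM sk Zsk mulNmx mulmxN opprK mxtrace_mulC.
have aC : a%:C != 0 :> R[i] by rewrite fmorph_eq0.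
apply: (scalerI aC); rewrite -casZ casE scaler_sumr -sumrN; apply: eq_bigr => p _.
by rewrite scalerA -rmorphM mulrN mulVKf // rmorphN /= trR scaleNr.
Qed.

End RealSpan.

Lemma ctr_adj (R : realType) m n (A : 'M[R[i]]_(m, n)) : ctr A = A^t*.
Proof. by rewrite /ctr map_trmx. Qed.

Lemma lin_ext_delta (K : pzRingType) m n (V : lmodType K) (f g : 'M[K]_(m, n) -> V) :
  linear f -> linear g ->
  (forall i j, f (delta_mx i j) = g (delta_mx i j)) -> f =1 g.
Proof.
move=> fl gl fg A.
pose F : {linear _ -> _} := HB.pack f (GRing.isLinear.Build _ _ _ _ _ fl).
pose G : {linear _ -> _} := HB.pack g (GRing.isLinear.Build _ _ _ _ _ gl).
rewrite -[f A]/(F A) -[g A]/(G A) [A]matrix_sum_delta !linear_sum.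
apply: eq_bigr => i _; rewrite !linear_sum; apply: eq_bigr => j _.
by rewrite !linearZ /= fg.
Qed.

Section Spans.

Variables (R : realType).

(** On traceless matrices [cas X] is multiplication by [a], so every element of su is an
    eigenvector. *)
Lemma span_su n d (X : 'I_n -> 'M[R[i]]_d) c' (a e : R) :
  casimir_family c' X -> 0 < a ->
  (forall i j, cas X (delta_mx i j) = a%:C *: delta_mx i j + ((i == j)%:R * e%:C)%:M) ->
  forall Z, su_mem Z <-> exists r : 'I_n -> R, \sum_p (r p)%:C *: X p = Z.
Proof.
move=> X_fam a0 casX Z; have [_ _ tr0 _ _] := X_fam.
split=> [[]|[r <-]]; last first.
  split; first by rewrite ctr_adj (real_span_skew X_fam).
  by rewrite (raddf_sum (@mxtrace R[i] d)) big1 //= => p _; rewrite mxtraceZ tr0 mulr0.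
rewrite ctr_adj => Zsk Ztr; apply: (cas_eigen_span X_fam _ Zsk (a := a)); first by rewrite gt_eqF.
rewrite {1}[Z]matrix_sum_delta linear_sum.
transitivity (a%:C *: Z + (\tr Z * e%:C)%:M); last by rewrite Ztr mul0r -scalemx1 scale0r addr0.
rewrite {2}[Z]matrix_sum_delta scaler_sumr /mxtrace mulr_suml
  (raddf_sum (@scalar_mx R[i] d)) -big_split.
apply: eq_bigr => i _ /=; rewrite linear_sum /= scaler_sumr.
rewrite [in RHS](_ : Z i i * e%:C = \sum_j Z i j * ((i == j)%:R * e%:C)); last first.
  rewrite (bigD1 i) //= eqxx mul1r big1 ?addr0 // => j ji.
  by rewrite eq_sym (negPf ji) mul0r mulr0.
rewrite (raddf_sum (@scalar_mx R[i] d)) -big_split; apply: eq_bigr => j _ /=.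
by rewrite linearZ /= casX scalerDr !scalerA [a%:C * _]mulrC scale_scalar_mx.
Qed.

Lemma sympJK l : sympJ R l *m sympJ R l = - 1%:M.
Proof.
rewrite /sympJ mulmx_block !mul0mx !mulmx0 !mul1mx !mulmx1 !add0r !addr0.
by rewrite scalar_mx_block opp_block_mx !oppr0.
Qed.

Lemma tr_sympJ l : (sympJ R l)^T = - sympJ R l.
Proof.
rewrite /sympJ tr_block_mx !trmx0 linearN /= !trmx1.
by rewrite opp_block_mx !oppr0 opprK.
Qed.

Lemma adj_sympJ l : (sympJ R l)^t* = - sympJ R l.
Proof.
rewrite tr_sympJ map_mxN; congr (- _).
by rewrite /sympJ map_block_mx !map_mx0 map_mxN !map_mx1.
Qed.

(** Complex sp is the fixed space of [A |-> J A^T J], and [cas] is [2 * c] there. Conversely,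
    [D = Y p - J (Y p)^T J] changes sign under this map, so [cas] kills it and it is
    trace-orthogonal to [Y p]. Being skew-Hermitian as well, [D] has norm zero. *)
Lemma span_symplectic n N (J : 'M[R[i]]_N) (Y : 'I_n -> 'M[R[i]]_N) c' (c : R) :
  J *m J = - 1%:M -> J^T = - J -> J^t* = - J ->
  casimir_family c' Y -> 0 < c ->
  (forall A, cas Y A = c%:C *: (A + J *m A^T *m J)) ->
  forall Z, Z^t* = - Z /\ Z^T *m J + J *m Z = 0 <->
    exists r : 'I_n -> R, \sum_p (r p)%:C *: Y p = Z.
Proof.
move=> JJ JT JA Y_fam c0 casY Z; have [sk _ _ _ _] := Y_fam.
have JAJ (A : 'M[R[i]]_N) : J *m (J *m A^T *m J)^T *m J = A.
  rewrite !trmx_mul trmxK JT !mulNmx !mulmxN opprK.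
  by rewrite !mulmxA JJ mulNmx mul1mx -mulmxA JJ mulmxN mulmx1 opprK.
have eqJ (A : 'M[R[i]]_N) : A^T *m J + J *m A = 0 <-> J *m A^T *m J = A.
  split=> [/eqP|e].
    rewrite -mulmxA addr_eq0 => /eqP ->.
    by rewrite mulmxN mulmxA JJ mulNmx mul1mx opprK.
  by rewrite -{2}e !mulmxA JJ !mulNmx mul1mx subrr.
split=> [[Zsk /eqJ ZJ]|[r <-]].
  apply: (cas_eigen_span Y_fam _ Zsk (a := 2 * c)).
    by rewrite mulf_neq0 ?gt_eqF // pnatr_eq0.
  rewrite casY ZJ -mulr2n -scaler_nat scalerA; congr (_ *: _).
  by rewrite rmorphM rmorph_nat mulrC.
split; first exact: (real_span_skew Y_fam).
apply/eqJ; rewrite linear_sum mulmx_sumr mulmx_suml; apply: eq_bigr => p _.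
rewrite linearZ -scalemxAr -scalemxAl; congr (_ *: _); apply/esym/eqP.
rewrite -subr_eq0; apply/eqP; set D := _ - _.
have DJ : J *m D^T *m J = - D.
  by rewrite /D linearB mulmxBr mulmxBl JAJ opprB.
have Dsk : D^t* = - D.
  have skT : ((Y p)^T)^t* = - (Y p)^T by rewrite -linearN -sk; apply/matrixP => i j; rewrite !mxE.
  rewrite /D adjB !adjM sk JA skT !mulNmx !mulmxN !opprK.
  by rewrite /D opprB addrC mulmxA.
have trD : \tr (D *m Y p) = 0.
  apply: (cas_eq0 Y_fam); rewrite casY -[X in _ + X]opprK; apply/eqP.
  by rewrite scaler_eq0 DJ opprK subrr eqxx orbT.
apply: (@trmul_adj_eq0 R[i] N N D); rewrite Dsk mulmxN {2}/D mulmxBr linearN linearB /= trD.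
rewrite sub0r opprK.
have -> : \tr (D *m (J *m (Y p)^T *m J)) = \tr (J *m D *m J *m (Y p)^T).
  by rewrite mulmxA mxtrace_mulC !mulmxA.
rewrite -mxtrace_tr !trmx_mul trmxK JT !mulNmx !mulmxN opprK.
by rewrite [J *m (_ *m J)]mulmxA DJ mulmxN linearN /= mxtrace_mulC trD oppr0.
Qed.

Lemma span_sp n l (Y : 'I_n -> 'M[R[i]]_(l + l)) c' (c : R) :
  casimir_family c' Y -> 0 < c ->
  (forall A, cas Y A = c%:C *: (A + sympJ R l *m A^T *m sympJ R l)) ->
  forall Z, sp_mem Z <-> exists r : 'I_n -> R, \sum_p (r p)%:C *: Y p = Z.
Proof.
move=> Y_fam c0 casY Z; rewrite /sp_mem ctr_adj.
exact: (span_symplectic (sympJK l) (tr_sympJ l) (adj_sympJ l) Y_fam c0 casY).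
Qed.

(** [P] and [Q] are mutually inverse but typed as rectangular matrices, so the equality of [d] and
    [N] requires no cast. *)
Definition realizes n d (X : 'I_n -> 'M[R[i]]_d) N (dom : 'M[R[i]]_N -> Prop) :=
  exists (P : 'M[R[i]]_(d, N)) (Q : 'M[R[i]]_(N, d)), [/\ P *m Q = 1%:M, Q *m P = 1%:M &
    forall Z, dom Z <-> exists r : 'I_n -> R, \sum_p (r p)%:C *: X p = P *m Z *m Q].

Lemma realizes_conj n d (X : 'I_n -> 'M[R[i]]_d) N (dom : 'M[R[i]]_N -> Prop)
    (U : 'M[R[i]]_d) :
  U \is unitarymx -> realizes (fun p => U *m X p *m U^t*) dom -> realizes X dom.
Proof.
move=> Uu [P [Q [PQ QP PQdom]]].
have [V VE] : exists V, V = U^t* by exists (U^t*).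
have UV : U *m V = 1%:M by rewrite VE; apply/unitarymxP.
have VU : V *m U = 1%:M by apply: mulmx1C.
exists (V *m P), (Q *m U); split.
- by rewrite -mulmxA [P *m (_ *m _)]mulmxA PQ mul1mx.
- by rewrite -mulmxA [U *m (_ *m _)]mulmxA UV mul1mx.
move=> Z; have [h1 h2] := PQdom Z.
have spanE (r : 'I_n -> R) : \sum_p (r p)%:C *: (U *m X p *m U^t*)
    = U *m (\sum_p (r p)%:C *: X p) *m V.
  rewrite mulmx_sumr mulmx_suml; apply: eq_bigr => p _.
  by rewrite -VE -scalemxAr -scalemxAl.
split=> [/h1[r]|[r re]].
  rewrite spanE => re; exists r.
  have -> : V *m P *m Z *m (Q *m U) = V *m (P *m Z *m Q) *m U by rewrite !mulmxA.
  by rewrite -re !mulmxA VU mul1mx -mulmxA VU mulmx1.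
apply: h2; exists r; rewrite spanE re.
have -> : V *m P *m Z *m (Q *m U) = V *m (P *m Z *m Q) *m U by rewrite !mulmxA.
by rewrite !mulmxA UV mul1mx -mulmxA UV mulmx1.
Qed.

Lemma realizes_su n d (X : 'I_n -> 'M[R[i]]_d) c' (a e : R) :
  casimir_family c' X -> 0 < a ->
  (forall i j, cas X (delta_mx i j) = a%:C *: delta_mx i j + ((i == j)%:R * e%:C)%:M) ->
  exists2 l, (0 < l)%N & d = l.+1 /\ realizes X (@su_mem R l.+1).
Proof.
case: d X => [|[|l]] X X_fam a0 casX.
- by have [_ _ _ _ [p]] := X_fam; rewrite [X p]flatmx0 eqxx.
- have [_ _ tr0 _ [p]] := X_fam.
  by rewrite [X p]mx11_scalar -trace_mx11 tr0 -scalemx1 scale0r eqxx.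
exists l.+1 => //; split=> //; exists 1%:M, 1%:M; rewrite mulmx1; split=> // Z.
by rewrite mul1mx mulmx1; exact: (span_su X_fam a0 casX Z).
Qed.

(** [cas X A] is [c] times [A - K A^T K^*], where [K] is the matrix of the form defined by [mate]
    and [s]. A monomial unitary [W], which lists the pairs and absorbs the phases, turns it into
    [W K W^T = J]; being bilinear, the form transforms by congruence and not by conjugation. *)
Lemma realizes_sp n d (X : 'I_n -> 'M[R[i]]_d) c' (c : R)
    (mate : 'I_d -> 'I_d) (s : 'I_d -> R[i]) :
  casimir_family c' X -> 0 < c ->
  involutive mate -> (forall i, mate i != i) ->
  (forall i, s (mate i) = - s i) -> (forall i, s i * (s i)^*%R = 1) ->
  (forall i j, cas X (delta_mx i j) = c%:C *: (delta_mx i j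
     - (s i * (s j)^*%R) *: delta_mx (mate j) (mate i))) ->
  exists2 l, (0 < l)%N & d = (l + l)%N /\ realizes X (@sp_mem R l).
Proof.
move=> X_fam c0 mateK mate_neq s_mate s_norm casX.
have [l [f [dE f_inj f_mate]]] := mate_enum mateK mate_neq.
subst d; exists l.
  have [_ _ _ _ [p /matrix0Pn[i _]]] := X_fam.
  by have := leq_ltn_trans (leq0n i) (ltn_ord i); rewrite addn_gt0 orbb.
split=> //.
(* With this choice the upper right entry of [W K W^T] at a pair is [s] times its conjugate, that is
   1. *)
pose ph p := if split p is inl _ then - s (f p) else 1.
have phl k : ph (lshift l k) = - s (f (lshift l k)) by rewrite /ph (unsplitK (inl k)).
have phr k : ph (rshift l k) = 1 by rewrite /ph (unsplitK (inr k)).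
have ph_norm p : ph p * (ph p)^*%R = 1.
  by rewrite /ph; case: (split p) => _; rewrite ?rmorphN ?mulrNN ?s_norm ?rmorph1 ?mulr1.
pose W : 'M[R[i]]_(l + l) := \matrix_(p, k) ((k == f p)%:R * ph p).
have WL q (A : 'M[R[i]]_(l + l, q)) a b : (W *m A) a b = ph a * A (f a) b.
  rewrite mxE (bigD1 (f a)) //= big1 ?addr0 => [|k kf]; rewrite mxE.
    by rewrite eqxx mul1r.
  by rewrite (negPf kf) !mul0r.
have WR q (A : 'M[R[i]]_(q, l + l)) a b : (A *m W^T) a b = A a (f b) * ph b.
  rewrite mxE (bigD1 (f b)) //= big1 ?addr0 => [|k kf]; rewrite !mxE.
    by rewrite eqxx mul1r.
  by rewrite (negPf kf) mul0r mulr0.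
have Wu : W \is unitarymx.
  apply/unitarymxP/matrixP => p q; rewrite WL !mxE (inj_eq f_inj).
  have [<- | _] := eqVneq p q; first by rewrite mul1r ph_norm.
  by rewrite mul0r conjC0 mulr0.
pose K : 'M[R[i]]_(l + l) := \matrix_(m, k) ((m == mate k)%:R * (s k)^*%R).
have casK A : cas X A = c%:C *: (A - K *m A^T *m K^t*).
  have fl : linear (fun A : 'M[R[i]]_(l + l) => c%:C *: (A - K *m A^T *m K^t*)).
    move=> x A1 A2; have -> : (x *: A1 + A2)^T = x *: A1^T + A2^T by rewrite linearP.
    rewrite mulmxDr mulmxDl -scalemxAr -scalemxAl opprD addrACA -scalerBr scalerDr.
    by rewrite !scalerA mulrC.
  apply: (lin_ext_delta (cas_is_linear X) fl) => i j; rewrite casX; congr (_ *: (_ - _)).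
  apply/matrixP => m k; rewrite trmx_delta mul_deltaE !mxE.
  case: (m == mate j); case: (k == mate i);
    rewrite /= ?mul0r ?mul1r ?mulr0 ?conjC0 ?mulr0 // mulr1 conjCK mulrC //.
have WKW : W *m K *m W^T = sympJ R l.
  apply/matrixP => p q; rewrite WR WL mxE.
  rewrite -[p]splitK -[q]splitK; case: (split p) => k; case: (split q) => k' /=.
  - by rewrite /sympJ block_mxEul mxE -f_mate (inj_eq f_inj) eq_lrshift mul0r mulr0 mul0r.
  - rewrite /sympJ block_mxEur mxE phl phr f_mate mateK (inj_eq f_inj) eq_lshift.
    rewrite s_mate rmorphN mulr1 mulrN mulrNN; have [-> | _] := eqVneq k k'.
      by rewrite mul1r s_norm.
    by rewrite mul0r mulr0.
  - rewrite /sympJ block_mxEdl !mxE phl phr -f_mate (inj_eq f_inj) eq_rshift mul1r.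
    have [_ | _] := eqVneq k k'; first by rewrite mul1r mulrN mulrC s_norm.
    by rewrite !mul0r oppr0.
  - rewrite /sympJ block_mxEdr mxE [f (rshift l k')]f_mate mateK (inj_eq f_inj).
    by rewrite eq_rlshift mul0r mulr0 mul0r.
clearbody W K; apply: (realizes_conj Wu); exists 1%:M, 1%:M; rewrite mulmx1; split=> // Z.
rewrite mul1mx mulmx1.
apply: (span_sp (casimir_family_conj Wu X_fam) c0) => A.
rewrite cas_conj // casK -scalemxAr -scalemxAl; congr (_ *: _).
have WV : W *m W^t* = 1%:M by apply/unitarymxP.
have WWT : (W^t*)^T = (W^T)^t* by rewrite map_trmx.
rewrite mulmxBr mulmxBl; congr (_ + _).
  by rewrite !mulmxA WV mul1mx -mulmxA WV mulmx1.
rewrite -[RHS]opprK; congr (- _); rewrite -mulmxN -adj_sympJ -WKW.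
by rewrite 2!adjM 2!trmx_mul WWT !mulmxA.
Qed.

Theorem casimir_family_realizes n d (X : 'I_n -> 'M[R[i]]_d) c' :
  casimir_family c' X ->
  exists2 l, (0 < l)%N &
    d = (l + l)%N /\ realizes X (@sp_mem R l) \/ d = l.+1 /\ realizes X (@su_mem R l.+1).
Proof.
move=> X_fam; have [sk inv _ _ _] := X_fam.
have [U Uu Ud] := cas_diagonalize sk inv.
have Y_fam := casimir_family_conj Uu X_fam.
case: (family_dichotomy Y_fam) => [i|[a [e [a0 casY]]]|[c c0 [mate [s [mK mN sm sn casY]]]]].
- by rewrite cas_conj.
- have [l l0 [dE real]] := realizes_su Y_fam a0 casY.
  by exists l => //; right; split=> //; apply: realizes_conj real.
- have [l l0 [dE real]] := realizes_sp Y_fam c0 mK mN sm sn casY.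
  by exists l => //; left; split=> //; apply: realizes_conj real.
Qed.

End Spans.

(** * Unitarity *)

Section ComplexContinuity.

Import numFieldNormedType.Exports.
Local Open Scope classical_set_scope.

Variables (R : realType) (T : topologicalType).

(** Stated through the two real parts, to match the real coordinates in which compactness is
    used. *)
Definition ccontinuous (f : T -> R[i]) :=
  continuous (fun x => complex.Re (f x) : R) /\ continuous (fun x => complex.Im (f x) : R).

Lemma ccontinuous_cst c : ccontinuous (fun=> c).
Proof. by split=> x; apply: cst_continuous. Qed.

Lemma ccontinuousD f g : ccontinuous f -> ccontinuous g -> ccontinuous (fun x => f x + g x).
Proof.
move=> [fr fi] [gr gi]; split.
  have -> : (fun x => complex.Re (f x + g x)) = (fun x => complex.Re (f x) + complex.Re (g x)).
    by apply/funext => x; rewrite raddfD.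
  by move=> x; apply: cvgD; [apply: fr|apply: gr].
have -> : (fun x => complex.Im (f x + g x)) = (fun x => complex.Im (f x) + complex.Im (g x)).
  by apply/funext => x; rewrite raddfD.
by move=> x; apply: cvgD; [apply: fi|apply: gi].
Qed.

Lemma ccontinuousM f g : ccontinuous f -> ccontinuous g -> ccontinuous (fun x => f x * g x).
Proof.
move=> [fr fi] [gr gi]; split.
  have -> : (fun x => complex.Re (f x * g x))
      = (fun x => complex.Re (f x) * complex.Re (g x) - complex.Im (f x) * complex.Im (g x)).
    by apply/funext => x; case: (f x) => a b; case: (g x).
  by move=> x; apply: cvgB; apply: cvgM; by [apply: fr|apply: gr|apply: fi|apply: gi].
have -> : (fun x => complex.Im (f x * g x))
    = (fun x => complex.Re (f x) * complex.Im (g x) + complex.Im (f x) * complex.Re (g x)).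
  by apply/funext => x; case: (f x) => a b; case: (g x).
by move=> x; apply: cvgD; apply: cvgM; by [apply: fr|apply: gr|apply: fi|apply: gi].
Qed.

Lemma ccontinuous_sum (I : Type) (s : seq I) (f : I -> T -> R[i]) :
  (forall i, ccontinuous (f i)) -> ccontinuous (fun x => \sum_(i <- s) f i x).
Proof.
move=> fc; elim: s => [|i s IH].
  have -> : (fun x : T => \sum_(i <- [::]) f i x) = fun=> 0 by apply/funext => x; rewrite big_nil.
  exact: ccontinuous_cst.
have -> : (fun x : T => \sum_(j <- i :: s) f j x) = (fun x => f i x + \sum_(j <- s) f j x).
  by apply/funext => x; rewrite big_cons.
exact: ccontinuousD.
Qed.

End ComplexContinuity.

Section MinimalNorm.

Import numFieldNormedType.Exports.
Local Open Scope classical_set_scope.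

Variables (R : realType) (n d : nat).
Local Notation C := R[i].

Definition nrm2 m p (A : 'M[C]_(m, p)) : R :=
  \sum_i \sum_j ((complex.Re (A i j)) ^+ 2 + (complex.Im (A i j)) ^+ 2).

Lemma nrm2_ge0 m p (A : 'M[C]_(m, p)) : 0 <= nrm2 A.
Proof. by rewrite sumr_ge0 // => i _; rewrite sumr_ge0 // => j _; rewrite addr_ge0 ?sqr_ge0. Qed.

Lemma nrm2_le m p (A : 'M[C]_(m, p)) i j :
  (complex.Re (A i j)) ^+ 2 <= nrm2 A /\ (complex.Im (A i j)) ^+ 2 <= nrm2 A.
Proof.
have h : (complex.Re (A i j)) ^+ 2 + (complex.Im (A i j)) ^+ 2 <= nrm2 A.
  rewrite /nrm2 (bigD1 i) //= (bigD1 j) //= -addrA lerDl addr_ge0 //.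
    by rewrite sumr_ge0 // => k _; rewrite addr_ge0 ?sqr_ge0.
  by rewrite sumr_ge0 // => k _; rewrite sumr_ge0 // => l _; rewrite addr_ge0 ?sqr_ge0.
have := sqr_ge0 (complex.Re (A i j)); have := sqr_ge0 (complex.Im (A i j)).
by split; lra.
Qed.

Lemma nrm2_eq0 m p (A : 'M[C]_(m, p)) : nrm2 A = 0 -> A = 0.
Proof.
move=> A0; apply/matrixP => i j; rewrite mxE.
have [] := nrm2_le A i j; rewrite A0 => h1 h2.
apply/eqP; rewrite eq_complex /= -[_ == _]sqrf_eq0 -[X in _ && X]sqrf_eq0.
by rewrite !eq_le h1 h2 !sqr_ge0.
Qed.

Lemma nrm2Z m p (a : R) (A : 'M[C]_(m, p)) : nrm2 (a%:C *: A) = a ^+ 2 * nrm2 A.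
Proof.
rewrite /nrm2 mulr_sumr; apply: eq_bigr => i _; rewrite mulr_sumr; apply: eq_bigr => j _.
by rewrite mxE; case: (A i j) => x y /=; ring.
Qed.

Local Notation I := (option 'I_n * 'I_d * 'I_d * bool)%type.

(** [None] holds the conjugating matrix, [Some i] the conjugate of [X i], and the boolean selects
    the imaginary part. Real row vectors make bounded closed sets compact. *)
Definition dec (p : 'rV[R]_#|{: I}|) (o : option 'I_n) : 'M[C]_d :=
  \matrix_(j, k) Complex (p 0 (enum_rank (o, j, k, false))) (p 0 (enum_rank (o, j, k, true))).

Definition enc (F : option 'I_n -> 'M[C]_d) : 'rV[R]_#|{: I}| :=
  \row_q let: (o, j, k, b) := enum_val q in
         if b then complex.Im (F o j k) else complex.Re (F o j k).

Lemma encK F o : dec (enc F) o = F o.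
Proof. by apply/matrixP => j k; rewrite !mxE !enum_rankK; case: (F o j k). Qed.

Lemma dec_continuous o j k : ccontinuous (fun p => dec p o j k).
Proof.
split.
  have -> : (fun p => complex.Re (dec p o j k)) = fun p => p 0 (enum_rank (o, j, k, false)).
    by apply/funext => p; rewrite mxE.
  exact: coord_continuous.
have -> : (fun p => complex.Im (dec p o j k)) = fun p => p 0 (enum_rank (o, j, k, true)).
  by apply/funext => p; rewrite mxE.
exact: coord_continuous.
Qed.

Lemma nrm2_continuous (T : topologicalType) m p (F : T -> 'M[C]_(m, p)) :
  (forall i j, ccontinuous (fun x => F x i j)) -> continuous (fun x => nrm2 (F x)).
Proof.
move=> Fc; have h : ccontinuous (fun x => \sum_i \sum_j F x i j * (F x i j)^*%R).
  apply: ccontinuous_sum => i; apply: ccontinuous_sum => j; apply: ccontinuousM => //.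
  have [Fr Fi] := Fc i j; split.
    have -> // : (fun x => complex.Re ((F x i j)^*%R : C)) = (fun x => complex.Re (F x i j)).
    by apply/funext => x; case: (F x i j).
  have -> : (fun x => complex.Im ((F x i j)^*%R : C)) = (fun x => - complex.Im (F x i j)).
    by apply/funext => x; case: (F x i j).
  by move=> x; apply: cvgN; apply: Fi.
have -> : (fun x => nrm2 (F x)) = (fun x => complex.Re (\sum_i \sum_j F x i j * (F x i j)^*%R)).
  apply/funext => x; rewrite raddf_sum; apply: eq_bigr => i _.
  rewrite raddf_sum; apply: eq_bigr => j _; case: (F x i j) => a b /=.
  by ring.
by case: h.
Qed.

Lemma sum_nrm2_continuous (T : topologicalType) m p (F : 'I_n -> T -> 'M[C]_(m, p)) :
  (forall i j k, ccontinuous (fun x => F i x j k)) ->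
  continuous (fun x => \sum_i nrm2 (F i x)).
Proof.
move=> Fc.
have h : ccontinuous (fun x => \sum_i (nrm2 (F i x))%:C).
  apply: ccontinuous_sum => i; split; first exact: nrm2_continuous.
  exact: cst_continuous.
have -> : (fun x => \sum_i nrm2 (F i x)) = (fun x => complex.Re (\sum_i (nrm2 (F i x))%:C)).
  by apply/funext => x; rewrite raddf_sum.
by case: h.
Qed.

Lemma mul_ccontinuous (T : topologicalType) m p q
    (F : T -> 'M[C]_(m, p)) (G : T -> 'M[C]_(p, q)) :
  (forall i j, ccontinuous (fun x => F x i j)) -> (forall i j, ccontinuous (fun x => G x i j)) ->
  forall i j, ccontinuous (fun x => (F x *m G x) i j).
Proof.
move=> Fc Gc i j.
have -> : (fun x => (F x *m G x) i j) = (fun x => \sum_k F x i k * G x k j).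
  by apply/funext => x; rewrite mxE.
by apply: ccontinuous_sum => k; apply: ccontinuousM.
Qed.

Lemma sub_ccontinuous (T : topologicalType) m p (F G : T -> 'M[C]_(m, p)) :
  (forall i j, ccontinuous (fun x => F x i j)) -> (forall i j, ccontinuous (fun x => G x i j)) ->
  forall i j, ccontinuous (fun x => (F x - G x) i j).
Proof.
move=> Fc Gc i j.
have -> : (fun x => (F x - G x) i j) = (fun x => F x i j + (-1) * G x i j).
  by apply/funext => x; rewrite !mxE mulN1r.
by apply: ccontinuousD => //; apply: ccontinuousM => //; apply: ccontinuous_cst.
Qed.

Variable X : 'I_n -> 'M[C]_d.
Hypothesis intertwiner_unit : forall g (Y : 'I_n -> 'M[C]_d),
  g != 0 -> (forall i, g *m X i = Y i *m g) -> g \in unitmx.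
Hypothesis d_gt0 : (0 < d)%N.

Let N0 := \sum_i nrm2 (X i).

(** The relation [g X_i = Y_i g] contains no inverse and so passes to limits, while [|g| = 1] keeps
    the limit from being zero. *)
Definition orbit_set : set 'rV[R]_#|{: I}| := [set p |
  [/\ nrm2 (dec p None) = 1,
      \sum_i nrm2 (dec p None *m X i - dec p (Some i) *m dec p None) = 0 &
      \sum_i nrm2 (dec p (Some i)) <= N0]].

Lemma orbit_set_closed : closed orbit_set.
Proof.
have -> : orbit_set = (fun p => nrm2 (dec p None)) @^-1` [set 1]
  `&` ((fun p => \sum_i nrm2 (dec p None *m X i - dec p (Some i) *m dec p None)) @^-1` [set 0]
  `&` (fun p => \sum_i nrm2 (dec p (Some i))) @^-1` [set x | x <= N0]).
  by apply/seteqP; split=> p /= => [[? ? ?]|[? [? ?]]]; do ![split].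
apply: closedI; [|apply: closedI]; apply: closed_comp; try by [exact: closed_eq|exact: closed_le].
- by move=> x _; apply: nrm2_continuous => i j; apply: dec_continuous.
- move=> x _; apply: sum_nrm2_continuous => i; apply: sub_ccontinuous.
    apply: mul_ccontinuous => j k; [exact: dec_continuous|exact: ccontinuous_cst].
  by apply: mul_ccontinuous => j k; exact: dec_continuous.
- by move=> x _; apply: sum_nrm2_continuous => i j k; apply: dec_continuous.
Qed.

Lemma orbit_set_compact : compact orbit_set.
Proof.
pose M := 2 + N0.
have N0_ge0 : 0 <= N0 by rewrite sumr_ge0 // => i _; rewrite nrm2_ge0.
have bound (x : R) : x ^+ 2 <= 1 + N0 -> - M <= x <= M.
  by move=> h; apply/andP; split; rewrite /M; nra.
have boxc : compact [set v : 'rV[R]_#|{: I}| | forall i, `[- M, M] (v ord0 i)].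
  by apply: (@rV_compact R _ (fun=> `[- M, M])) => _; apply: segment_compact.
apply: (subclosed_compact orbit_set_closed boxc) => p /= [h1 _ h3] q.
rewrite -[q]enum_valK in_itv /=; apply: bound.
case: (enum_val q) => [[[o j] k] b].
have : nrm2 (dec p o) <= 1 + N0.
  case: o => [i|]; last by rewrite h1 lerDl.
  apply: le_trans (_ : N0 <= _); last by rewrite lerDr.
  by apply: le_trans h3; rewrite (bigD1 i) //= lerDl sumr_ge0 // => ? _; rewrite nrm2_ge0.
apply: le_trans; have [] := nrm2_le (dec p o) j k; rewrite mxE /=.
by case: b.
Qed.

Lemma normalize_nrm2 (g : 'M[C]_d) : g != 0 -> exists a : R, a != 0 /\ nrm2 (a%:C *: g) = 1.
Proof.
move=> g0; have ng : nrm2 g != 0 by apply: contraNneq g0 => /nrm2_eq0 ->.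
exists (Num.sqrt (nrm2 g))^-1; split.
  by rewrite invr_eq0 sqrtr_eq0 -ltNge lt_neqAle eq_sym ng nrm2_ge0.
by rewrite nrm2Z exprVn sqr_sqrtr ?nrm2_ge0 // mulVf.
Qed.

(* The set of pairs [(g, Y)] with [|g| = 1], [g X_i = Y_i g] and [|Y| <= |X|] is
   compact, and [g] is automatically invertible on it. *)
Theorem minimal_conjugate : exists g (Y : 'I_n -> 'M[C]_d),
  [/\ g \in unitmx, forall i, g *m X i = Y i *m g &
     forall u Z, u \in unitmx -> (forall i, u *m Y i = Z i *m u) ->
       \sum_i nrm2 (Y i) <= \sum_i nrm2 (Z i)].
Proof.
have mem g (Y : 'I_n -> 'M[C]_d) : g != 0 -> (forall i, g *m X i = Y i *m g) ->
    \sum_i nrm2 (Y i) <= N0 ->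
    exists2 p, orbit_set p & forall i, dec p (Some i) = Y i.
  move=> g0 gX YN; have [a [a0 na]] := normalize_nrm2 g0.
  exists (enc (fun o => if o is Some i then Y i else a%:C *: g)) => [|i]; last by rewrite encK.
  split; rewrite ?encK //.
    rewrite big1 // => i _; rewrite !encK -scalemxAl gX scalemxAr subrr /nrm2 big1 // => j _.
    by rewrite big1 // => k _; rewrite mxE /= expr0n addr0.
  by rewrite (eq_bigr (fun i => nrm2 (Y i))) // => i _; rewrite encK.
have ne : orbit_set !=set0.
  have one0 : (1%:M : 'M[C]_d) != 0.
    by rewrite -mxrank_eq0 mxrank1 -lt0n.
  have [//|i|//|p Kp _] := mem 1%:M X; first by rewrite mul1mx mulmx1.
  by exists p.
pose f (p : 'rV[R]_#|{: I}|) := \sum_i nrm2 (dec p (Some i)).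
have fc : continuous f by apply: sum_nrm2_continuous => i j k; apply: dec_continuous.
have [p] := EVT_min_rV ne orbit_set_compact (continuous_subspaceT fc).
rewrite inE => -[h1 h2 h3] pmin.
have gY i : dec p None *m X i = dec p (Some i) *m dec p None.
  have /allP/(_ i (mem_index_enum _))/eqP/nrm2_eq0/eqP :
      all (fun i => nrm2 (dec p None *m X i - dec p (Some i) *m dec p None) == 0)
        (index_enum 'I_n).
    rewrite -[X in all X _]/(fun i => true ==> _) -psumr_eq0 ?h2 // => j _.
    exact: nrm2_ge0.
  by rewrite subr_eq0 => /eqP.
have g0 : dec p None != 0.
  apply/eqP => e; move: h1; rewrite e /nrm2 big1 => [/eqP|j _].
    by rewrite eq_sym oner_eq0.
  by rewrite big1 // => k _; rewrite mxE /= expr0n addr0.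
have gu := intertwiner_unit g0 gY.
exists (dec p None), (fun i => dec p (Some i)); split=> // u Z uu uZ.
(* A conjugate of norm above [N0] is no competitor; any other comes, after rescaling the conjugating
   matrix, from a point of the compact set. *)
have [ZN|/ltW ZN] := leP (\sum_i nrm2 (Z i)) N0; last exact: le_trans h3 ZN.
have [||//|q Kq qZ] := mem (u *m dec p None) Z.
- apply: contraNneq g0 => e; have : invmx u *m (u *m dec p None) = 0 by rewrite e mulmx0.
  by rewrite mulmxA mulVmx // mul1mx => ->.
- by move=> i; rewrite -mulmxA gY !mulmxA uZ.
have := pmin q; rewrite inE => /(_ Kq); rewrite /f.
by rewrite [X in _ <= X](eq_bigr (fun i => nrm2 (Z i))) // => i _; rewrite qZ.
Qed.

End MinimalNorm.

(** * Vanishing moment and skew-Hermitian form *)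

(** For [|t| <= 1] the higher terms are at most [K t^2]. The point [t = - a / D] makes [t a + t^2 K]
    negative because [D > K]; the summand [|a|] of [D] ensures [|t| <= 1]. *)
Lemma quartic_ge0 (R : realFieldType) (a b c e : R) :
  (forall t, 0 <= t * a + t ^+ 2 * b + t ^+ 3 * c + t ^+ 4 * e) -> a = 0.
Proof.
move=> h; apply/eqP/negPn/negP => a0.
pose K := `|b| + `|c| + `|e|; have K0 : 0 <= K by rewrite !addr_ge0.
have [sb sc se] : [/\ b <= `|b|, `|c| = `|c| & e <= `|e|] by rewrite !ler_norm.
pose D := 1 + K + `|a|; have D0 : 0 < D by have := normr_ge0 a; rewrite /D; lra.
pose t := - a / D.
have t1 : `|t| <= 1.
  rewrite normrM normrN normfV (gtr0_norm D0) ler_pdivrMr // mul1r /D.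
  by lra.
have t2 : t ^+ 2 <= 1 by rewrite -real_normK ?num_real // expr_le1.
have b2 : t ^+ 2 * b <= t ^+ 2 * `|b| by rewrite ler_wpM2l ?sqr_ge0.
have e2 : t ^+ 4 * e <= t ^+ 2 * `|e|.
  rewrite (_ : t ^+ 4 = t ^+ 2 * t ^+ 2); last by rewrite -exprD.
  rewrite -mulrA ler_wpM2l ?sqr_ge0 //; apply: le_trans (ler_norm _) _.
  by rewrite normrM ger0_norm ?sqr_ge0 // ler_piMl.
have c2 : t ^+ 3 * c <= t ^+ 2 * `|c|.
  rewrite exprSr -mulrA ler_wpM2l ?sqr_ge0 //; apply: le_trans (ler_norm _) _.
  by rewrite normrM ler_piMl.
have := h t; apply/negP; rewrite -ltNge.
apply: (@le_lt_trans _ _ (t * a + t ^+ 2 * K)); first by rewrite /K !mulrDr; lra.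
have -> : t * a + t ^+ 2 * K = (a / D) ^+ 2 * (K - D) by rewrite /t; field; rewrite gt_eqF.
have KD : K - D < 0 by have := normr_ge0 a; rewrite /D; lra.
by rewrite pmulr_rlt0 // exprn_even_gt0 //= mulf_neq0 // invr_eq0 gt_eqF.
Qed.

(** Jacobi identity for [ad A] and [ad B], combined with the invariance of the trace form. For
    [B = A^t*] and [Q = P^t*] it pairs [[A, A^*]] with a summand of the moment. *)
Lemma tr_ad_comm (K : comPzRingType) d (A B P Q : 'M[K]_d) :
  \tr ((A *m (B *m P - P *m B) - (B *m P - P *m B) *m A) *m Q)
  - \tr ((B *m (A *m P - P *m A) - (A *m P - P *m A) *m B) *m Q)
  = \tr ((A *m B - B *m A) *m (P *m Q - Q *m P)).
Proof.
have expand (U V : 'M[K]_d) :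
    \tr ((U *m (V *m P - P *m V) - (V *m P - P *m V) *m U) *m Q)
    = \tr (U *m V *m P *m Q) - \tr (U *m P *m V *m Q)
      - (\tr (V *m P *m U *m Q) - \tr (V *m U *m Q *m P)).
  rewrite mulmxBl mulmxBr !mulmxBl !(raddfB (@mxtrace K d)) /= !mulmxA.
  by congr (_ - (_ - _)); rewrite -!mulmxA mxtrace_mulC !mulmxA.
rewrite !expand mulmxBl !mulmxBr !(raddfB (@mxtrace K d)) /= !mulmxA.
by ring.
Qed.

(** Off-diagonal matrix units detect the off-diagonal entries. On the diagonal, [u w] with
    [u = e_i + e_j] and [w = e_i^T - e_j^T] has square zero and detects [M i i - M j j]. Thus
    variations of square zero see the whole traceless part. *)
Lemma square_zero_trace_eq0 (K : numFieldType) d (M : 'M[K]_d) : (0 < d)%N ->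
  (forall s, s *m s = 0 -> \tr (s *m M) = 0) -> \tr M = 0 -> M = 0.
Proof.
move=> d_gt0 sqz trM.
have off i j : i != j -> M j i = 0.
  move=> ij; have := sqz (delta_mx i j).
  by rewrite mul_delta_mx_0 1?eq_sym // tr_delta_mul; apply.
have diag i j : M i i = M j j.
  have [-> // | ij] := eqVneq i j; have ji : j != i by rewrite eq_sym.
  pose u : 'cV[K]_d := delta_mx i 0 + delta_mx j 0.
  pose w : 'rV[K]_d := delta_mx 0 i - delta_mx 0 j.
  have wu : w *m u = 0.
    rewrite /w /u mulmxBl !mulmxDr !mul_delta_mx_cond !eqxx (negPf ij) (negPf ji).
    by rewrite !mulr0n !mulr1n addr0 add0r subrr.
  have := sqz (u *m w).
  rewrite mulmxA -[u *m w *m u]mulmxA wu mulmx0 mul0mx => /(_ erefl).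
  rewrite mulmxDl !mulmxBr !mul_delta_mx !mulmxDl !mulNmx.
  rewrite !(raddfD (@mxtrace K d), raddfN (@mxtrace K d)) /= !tr_delta_mul (off i j ij)
    (off j i ji).
  by rewrite !(oppr0, addr0, add0r) => /eqP; rewrite subr_eq0 => /eqP.
apply/matrixP => i j; rewrite mxE; have [-> | ij] := eqVneq i j; last by rewrite off // eq_sym.
have : \tr M = M j j *+ d.
  by rewrite /mxtrace (eq_bigr (fun=> M j j)) ?sumr_const ?card_ord // => k _; exact: diag.
by rewrite trM => /esym/eqP; rewrite mulrn_eq0 gtn_eqF //= => /eqP.
Qed.

Section MomentZero.

Variables (C : numClosedFieldType) (n d : nat) (Y : 'I_n -> 'M[C]_d).

Local Notation "[[ A , B ]]" := (A *m B - B *m A) (at level 0).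

Lemma tr_ad_adj (A P Q : 'M[C]_d) :
  \tr (P *m ([[A^t*, Q]])^t*) = \tr ([[A, P]] *m Q^t*).
Proof.
rewrite adjB !adjM trmxCK mulmxBr mulmxBl !(raddfB (@mxtrace C d)) /= -!mulmxA.
by congr (_ - _); rewrite [in LHS]mulmxA mxtrace_mulC.
Qed.

Hypothesis moment0 : \sum_i [[Y i, (Y i)^t*]] = 0.
Hypothesis Y_tr0 : forall i, \tr (Y i) = 0.
Hypothesis d_gt0 : (0 < d)%N.
Variable O : 'I_n -> 'I_n -> 'I_n -> C.
Hypothesis O_real : forall j i k, (O j i k)^*%R = O j i k.
Hypothesis Y_br : forall j i, [[Y j, Y i]] = \sum_k O j i k *: Y k.
Hypothesis O_anti : forall j i k, O j i k = - O j k i.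
Hypothesis Y_irr : forall A, (forall i, [[A, Y i]] = 0) -> exists a, A = a%:M.

(* Write [A . Y] for the family of the [A Y_i - Y_i A].  The family [Y z . Y] is an
   antisymmetric recombination of [Y], whence [<A . Y, A^* . Y> = - |A . Y|^2]; and
   [|A^* . Y| = |A . Y|] since the moment vanishes.  Hence [(A + A^* ) . Y = 0]. *)
Theorem moment_zero_skew z : (Y z)^t* = - Y z.
Proof.
set A := Y z; pose a i := [[A, Y i]]; pose b i := [[A^t*, Y i]].
have aE i : a i = \sum_k O z i k *: Y k by rewrite /a Y_br.
pose saa := \sum_i \tr (a i *m (a i)^t*).
have ab : \sum_i \tr (a i *m (b i)^t*) = - saa.
  pose s i k := O z i k * \tr (a k *m (Y i)^t*).
  transitivity (\sum_i \sum_k s i k).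
    apply: eq_bigr => i _; rewrite tr_ad_adj aE mulmx_sumr mulmx_suml -sumrB mulmx_suml.
    rewrite (raddf_sum (@mxtrace C d)); apply: eq_bigr => k _.
    by rewrite /= -scalemxAr -scalemxAl -scalerBr -scalemxAl mxtraceZ.
  rewrite exchange_big -sumrN; apply: eq_bigr => k _.
  rewrite {2}aE adj_sum mulmx_sumr (raddf_sum (@mxtrace C d)) -sumrN; apply: eq_bigr => i _.
  by rewrite /= adjZ O_real -scalemxAr mxtraceZ /s [O z i k]O_anti mulNr.
have saa_real : saa^*%R = saa.
  by rewrite rmorph_sum; apply: eq_bigr => i _; rewrite /= -tr_adj adjM trmxCK.
have ba : \sum_i \tr (b i *m (a i)^t*) = - saa.
  rewrite -[in RHS]saa_real -rmorphN -ab rmorph_sum; apply: eq_bigr => i _.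
  by rewrite /= -tr_adj adjM trmxCK.
have bb : \sum_i \tr (b i *m (b i)^t*) = saa.
  apply/eqP; rewrite -subr_eq0 -sumrB; apply/eqP.
  transitivity (\tr ([[A, A^t*]] *m \sum_i [[Y i, (Y i)^t*]]));
    last by rewrite moment0 mulmx0 mxtrace0.
  rewrite mulmx_sumr (raddf_sum (@mxtrace C d)); apply: eq_bigr => i _.
  have := tr_ad_adj (A^t*) (a i) (Y i); rewrite trmxCK -/(a i) => ->.
  by rewrite tr_ad_adj tr_ad_comm.
have sab : \sum_i \tr ((a i + b i) *m (a i + b i)^t*) = 0.
  transitivity (saa + \sum_i \tr (a i *m (b i)^t*) + \sum_i \tr (b i *m (a i)^t*)
    + \sum_i \tr (b i *m (b i)^t*)); last by rewrite ab ba bb; ring.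
  rewrite /saa -!big_split; apply: eq_bigr => i _ /=.
  by rewrite adjD mulmxDl !mulmxDr !(raddfD (@mxtrace C d)) /=; ring.
have comm i : [[A + A^t*, Y i]] = 0.
  rewrite mulmxDl mulmxDr opprD addrACA; apply: trmul_adj_eq0; apply/eqP.
  move/eqP: sab; rewrite psumr_eq0 => [/allP/(_ i (mem_index_enum _))//|j _].
  exact: trmul_adj_ge0.
(* [A + A^*] commutes with the whole family, so it is scalar; its trace is zero. *)
have [x xE] := Y_irr comm.
have x0 : x = 0.
  have : \tr (A + A^t*) = 0 by rewrite mxtraceD tr_adj Y_tr0 conjC0 addr0.
  rewrite xE mxtrace_scalar => /eqP.
  by rewrite mulrn_eq0 gtn_eqF //= => /eqP.
by apply/eqP; rewrite -addr_eq0 addrC xE x0 -scalemx1 scale0r.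
Qed.

End MomentZero.

Section MinimalVectors.

Variables (R : realType).
Local Notation C := R[i].

Definition ip m p (A B : 'M[C]_(m, p)) : R := complex.Re (\tr (B *m A^t*)).

Lemma nrm2E m p (A : 'M[C]_(m, p)) : (nrm2 A)%:C = \tr (A *m A^t*).
Proof.
rewrite trmul_adj rmorph_sum; apply: eq_bigr => i _; rewrite rmorph_sum; apply: eq_bigr => j _.
rewrite normCK; case: (A i j) => x y /=.
by apply/eqP; rewrite eq_complex /=; apply/andP; split; apply/eqP; ring.
Qed.

Lemma nrm2_ip m p (A : 'M[C]_(m, p)) : nrm2 A = ip A A.
Proof. by rewrite /ip -nrm2E. Qed.

Lemma ip_sym m p (A B : 'M[C]_(m, p)) : ip A B = ip B A.
Proof.
rewrite /ip -[X in complex.Re X = _]conjCK -tr_adj adjM trmxCK.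
by case: (\tr _) => x y.
Qed.

Lemma ipDr m p (A B B' : 'M[C]_(m, p)) : ip A (B + B') = ip A B + ip A B'.
Proof. by rewrite /ip mulmxDl mxtraceD raddfD. Qed.

Lemma ipZr m p (A B : 'M[C]_(m, p)) (t : R) : ip A (t%:C *: B) = t * ip A B.
Proof.
by rewrite /ip -scalemxAl mxtraceZ; case: (\tr _) => x y /=; rewrite mul0r subr0.
Qed.

Lemma nrm2D m p (A B : 'M[C]_(m, p)) : nrm2 (A + B) = nrm2 A + 2 * ip A B + nrm2 B.
Proof.
rewrite !nrm2_ip ipDr [ip (A + B) A]ip_sym [ip (A + B) B]ip_sym !ipDr [ip B A]ip_sym.
by ring.
Qed.

Lemma nrm2_quartic m p (A B D : 'M[C]_(m, p)) (t : R) :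
  nrm2 (A + t%:C *: B + (t ^+ 2)%:C *: D)
  = nrm2 A + (t * (2 * ip A B) + t ^+ 2 * (nrm2 B + 2 * ip A D)
    + t ^+ 3 * (2 * ip B D) + t ^+ 4 * nrm2 D).
Proof.
rewrite !nrm2D !nrm2Z !ipZr [ip (_ + _) _]ip_sym ipDr ipZr [ip D A]ip_sym [ip D B]ip_sym.
by ring.
Qed.

Variables (n d : nat) (Y : 'I_n -> 'M[C]_d).
Hypothesis Y_min : forall u Z, u \in unitmx -> (forall i, u *m Y i = Z i *m u) ->
       \sum_i nrm2 (Y i) <= \sum_i nrm2 (Z i).

Local Notation "[[ A , B ]]" := (A *m B - B *m A) (at level 0).

(* For [s] of square zero, [1 + t s] has inverse [1 - t s], so the norm along the
   variation is a polynomial in [t] and no calculus is needed. *)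
Lemma minimal_variation s : s *m s = 0 -> \sum_i ip (Y i) [[s, Y i]] = 0.
Proof.
move=> ss; have : 2 * \sum_i ip (Y i) [[s, Y i]] = 0.
  pose B i := [[s, Y i]]; pose D i := - (s *m Y i *m s).
  apply: (@quartic_ge0 _ _ (\sum_i (nrm2 (B i) + 2 * ip (Y i) (D i)))
            (2 * \sum_i ip (B i) (D i)) (\sum_i nrm2 (D i))) => t.
  pose Z i := Y i + t%:C *: B i + (t ^+ 2)%:C *: D i.
  have uv : (1%:M + t%:C *: s) *m (1%:M - t%:C *: s) = 1%:M.
    rewrite mulmxDl !mulmxBr !mul1mx !mulmx1 -!scalemxAr -!scalemxAl ss !scaler0.
    by rewrite subr0 subrK.
  have [uu _] := mulmx1_unit uv.
  have := @Y_min (1%:M + t%:C *: s) Z uu.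
  have hZ i : (1%:M + t%:C *: s) *m Y i = Z i *m (1%:M + t%:C *: s).
    have -> : Z i = (1%:M + t%:C *: s) *m Y i *m (1%:M - t%:C *: s).
      rewrite /Z /B /D mulmxDl mulmxBr mul1mx mulmx1 -!scalemxAr mulmxDl -!scalemxAl.
      rewrite scalerBr scalerN scalerDr scalerA -rmorphM -expr2.
      by rewrite opprD -!addrA; congr (_ + _); rewrite addrCA [RHS]addrC -!addrA.
    by rewrite -[RHS]mulmxA (mulmx1C uv) mulmx1.
  move=> /(_ hZ); rewrite /Z.
  rewrite [X in _ <= X](eq_bigr _ (fun i _ => nrm2_quartic (Y i) (B i) (D i) t)).
  by rewrite big_split lerDl !big_split -!mulr_sumr /= big_split -mulr_sumr.
by move/eqP; rewrite mulf_eq0 pnatr_eq0 => /eqP.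
Qed.

Let M := \sum_i [[Y i, (Y i)^t*]].

(** The first variation only gives the real part; the imaginary part comes from ['i%C *: s], which
    is again of square zero. *)
Lemma minimal_variation_tr s : s *m s = 0 -> \tr (s *m M) = 0.
Proof.
have trE s' : s' *m s' = 0 -> complex.Re (\tr (s' *m M)) = 0.
  move=> /minimal_variation <-; rewrite /M mulmx_sumr (raddf_sum (@mxtrace C d)).
  rewrite (raddf_sum (@complex.Re R)); apply: eq_bigr => i _; rewrite /ip; congr (complex.Re _).
  rewrite mulmxBr mulmxBl !(raddfB (@mxtrace C d)) /= !mulmxA; congr (_ - _).
  by rewrite [LHS]mxtrace_mulC mulmxA.
move=> ss; have re := trE s ss.
have := trE ('i%C *: s); rewrite -!scalemxAl -scalemxAr ss !scaler0 => /(_ erefl).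
rewrite mxtraceZ; case: (\tr _) re => x y /= -> ; rewrite mul0r mul1r sub0r => /eqP.
by rewrite oppr_eq0 => /eqP ->.
Qed.

Hypothesis d_gt0 : (0 < d)%N.

Lemma minimal_moment : M = 0.
Proof.
apply: square_zero_trace_eq0 => //; first exact: minimal_variation_tr.
rewrite /M (raddf_sum (@mxtrace C d)) big1 // => i _.
by rewrite (raddfB (@mxtrace C d)) /= mxtrace_mulC subrr.
Qed.

End MinimalVectors.

(** * Reduction to matrices *)

Section InnerProduct.

Variables (R : rcfType) (g : vectType R) (B : g -> g -> R).
Hypothesis B_lin : forall (a : R) x y z, B (a *: x + y) z = a * B x z + B y z.
Hypothesis B_sym : forall x y, B x y = B y x.
Hypothesis B_pos : forall x, x != 0 -> 0 < B x x.

Lemma form0l z : B 0 z = 0.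
Proof. by have := B_lin (-1) 0 0 z; rewrite scaler0 addr0; lra. Qed.

Lemma formZl a x z : B (a *: x) z = a * B x z.
Proof. by rewrite -[a *: x]addr0 B_lin form0l addr0. Qed.

Lemma formDl x y z : B (x + y) z = B x z + B y z.
Proof. by rewrite -{1}[x]scale1r B_lin mul1r. Qed.

Lemma form_suml (I : finType) (F : I -> g) z : B (\sum_i F i) z = \sum_i B (F i) z.
Proof. by apply: (big_morph (B^~ z)) => [x y|]; [exact: formDl|exact: form0l]. Qed.

Lemma form_eq0 x : B x x = 0 -> x = 0.
Proof. by move=> x0; apply/eqP/negPn/negP => /B_pos; rewrite x0 ltxx. Qed.

Lemma orthonormal_size k (x : 'I_k -> g) :
  (forall i j, B (x i) (x j) = (i == j)%:R) -> (k <= \dim {:g})%N.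
Proof.
move=> xo; have xf : free [tuple x i | i < k].
  apply/freeP => a /(congr1 (B^~ _)) a0 i; have := a0 (x i); rewrite form0l form_suml.
  rewrite (bigD1 i) // big1 => [|j /andP[_ ji]].
    by rewrite formZl -tnth_nth tnth_mktuple xo eqxx mulr1 /= addr0.
  by rewrite formZl -tnth_nth tnth_mktuple xo (negPf ji) mulr0.
by move/eqP: xf; rewrite size_tuple => <-; rewrite dimvS ?subvf.
Qed.

(** One Gram-Schmidt step: if some [y] has a nonzero remainder after projection, the normalized
    remainder is put in front. *)
Lemma orthonormal_extend k (x : 'I_k -> g) :
  (forall i j, B (x i) (x j) = (i == j)%:R) ->
  (forall y, y = \sum_i B y (x i) *: x i) \/
  exists x' : 'I_k.+1 -> g, forall i j, B (x' i) (x' j) = (i == j)%:R.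
Proof.
move=> xo; pose r y := y - \sum_i B y (x i) *: x i.
have [[y ry]|nE] := pselect (exists y, r y != 0); last first.
  left=> y; apply/eqP; rewrite -subr_eq0; apply/negPn/negP => h.
  by apply: nE; exists y.
right; have rx j : B (r y) (x j) = 0.
  rewrite /r -scaleN1r addrC B_lin form_suml (bigD1 j) //= big1 => [|i ij].
    by rewrite formZl xo eqxx mulr1 addr0 mulN1r addNr.
  by rewrite formZl xo (negPf ij) mulr0.
pose u := (Num.sqrt (B (r y) (r y)))^-1 *: r y.
have ux j : B u (x j) = 0 by rewrite formZl rx mulr0.
have uu : B u u = 1.
  rewrite formZl B_sym formZl mulrA -expr2 exprVn sqr_sqrtr ?ltW ?B_pos //.
  by rewrite mulVf // gt_eqF ?B_pos.
exists (fun i => if unlift ord0 i is Some j then x j else u) => i j.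
case: (unliftP ord0 i) => [i'|] ->; case: (unliftP ord0 j) => [j'|] ->.
- by rewrite xo (inj_eq lift_inj).
- by rewrite B_sym ux eq_sym (negPf (neq_lift _ _)).
- by rewrite ux (negPf (neq_lift _ _)).
- by rewrite uu eqxx.
Qed.

Lemma orthonormal_basis : exists n (x : 'I_n -> g),
  (forall i j, B (x i) (x j) = (i == j)%:R) /\ forall y, y = \sum_i B y (x i) *: x i.
Proof.
suff ext m k (x : 'I_k -> g) : (forall i j, B (x i) (x j) = (i == j)%:R) ->
    (\dim {:g} <= k + m)%N -> exists n (x : 'I_n -> g),
    (forall i j, B (x i) (x j) = (i == j)%:R) /\ forall y, y = \sum_i B y (x i) *: x i.
  by apply: (ext (\dim {:g}) 0 (fun=> 0)) => // -[].
elim: m k x => [|m IH] k x xo sz;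
  (have [cx|[x' xo']] := orthonormal_extend xo; first by exists k, x).
  by have := leq_trans (orthonormal_size xo') sz; rewrite addn0 ltnn.
by apply: (IH _ x' xo'); rewrite addSnnS.
Qed.

End InnerProduct.

Section Representation.

Variables (R : realType) (g : vectType R) (br : g -> g -> g) (d : nat) (phi : g -> 'M[R[i]]_d).
Hypothesis br_ss : lie_semisimple br.
Hypothesis phi_rep : lie_rep br phi.
Hypothesis phi_inj : injective phi.

Let phi_lin (a : R) x y : phi (a *: x + y) = a%:C *: phi x + phi y.
Proof. by case: phi_rep. Qed.

Let phi_br x y : phi (br x y) = phi x *m phi y - phi y *m phi x.
Proof. by case: phi_rep. Qed.

Lemma rep0 : phi 0 = 0.
Proof.
have := phi_lin (-1) 0 0; rewrite scaler0 addr0 rmorphN rmorph1 scaleN1r addNr.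
by [].
Qed.

Lemma repZ a x : phi (a *: x) = a%:C *: phi x.
Proof. by rewrite -[a *: x]addr0 phi_lin rep0 addr0. Qed.

Lemma repD x y : phi (x + y) = phi x + phi y.
Proof. by rewrite -[x]scale1r phi_lin rmorph1 !scale1r. Qed.

Lemma rep_sum (I : finType) (F : I -> g) : phi (\sum_i F i) = \sum_i phi (F i).
Proof. by apply: (big_morph phi) => [x y|]; [exact: repD|exact: rep0]. Qed.

Variable B : g -> g -> R.
Hypothesis B_lin : forall (a : R) x y z, B (a *: x + y) z = a * B x z + B y z.
Hypothesis B_sym : forall x y, B x y = B y x.
Hypothesis B_pos : forall x, x != 0 -> 0 < B x x.
Hypothesis B_inv : forall x y z, B (br x y) z + B y (br x z) = 0.

Variables (n : nat) (x : 'I_n -> g).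
Hypothesis x_basis : forall y, y = \sum_i B y (x i) *: x i.

(* A linear form vanishing on brackets is [B z] for a central [z], and the
   center is an abelian ideal. *)
Lemma character_eq0 (f : g -> R) : (forall a y z, f (a *: y + z) = a * f y + f z) ->
  (forall y z, f (br y z) = 0) -> forall y, f y = 0.
Proof.
move=> f_lin f_br.
have f0 : f 0 = 0 by have := f_lin (-1) 0 0; rewrite scaler0 addr0; lra.
pose z := \sum_i f (x i) *: x i.
have fz y : f y = B z y.
  rewrite {1}[y]x_basis /z (form_suml B_lin).
  have -> : f (\sum_i B y (x i) *: x i) = \sum_i f (B y (x i) *: x i).
    apply: (big_morph f) => [u v|//].
    by have := f_lin 1 u v; rewrite scale1r mul1r.
  apply: eq_bigr => i _; rewrite (formZl B_lin) -[_ *: x i]addr0 f_lin f0 addr0 mulrC.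
  by rewrite B_sym.
have z_center y : br y z = 0.
  apply: (form_eq0 B_pos); have := B_inv y z (br y z).
  by rewrite -fz f_br addr0.
(* Brackets with multiples of [z] are computed through the faithful [phi]. *)
have phi_z y : phi y *m phi z = phi z *m phi y.
  by apply/eqP; rewrite -subr_eq0 -phi_br z_center rep0.
have lineP u : u \in <[z]>%VS -> forall y, br y u = 0 /\ br u y = 0.
  move=> /vlineP[k ->] y; split; apply: phi_inj; rewrite rep0 phi_br repZ;
  by rewrite -scalemxAl -scalemxAr phi_z subrr.
have /eqP : <[z]>%VS = 0%VS.
  have [_ ss] := br_ss; apply: ss => [y u /lineP/(_ y)[-> _]|u v /lineP/(_ v)[_ ->] //].
  exact: mem0v.
rewrite -dimv_eq0 dim_vline; have [z0 _ y|//] := eqVneq z 0.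
by rewrite fz z0 (form0l B_lin).
Qed.

Lemma rep_trace y : \tr (phi y) = 0.
Proof.
have tr_br u v : \tr (phi (br u v)) = 0.
  by rewrite phi_br (raddfB (@mxtrace R[i] d)) /= mxtrace_mulC subrr.
have re := @character_eq0 (fun y => complex.Re (\tr (phi y))).
have im := @character_eq0 (fun y => complex.Im (\tr (phi y))).
apply/eqP; rewrite eq_complex re ?im ?eqxx //.
- by move=> a u v; rewrite phi_lin mxtraceD mxtraceZ; case: (\tr _) => p q;
  case: (\tr _) => p' q' /=; ring.
- by move=> u v; rewrite tr_br.
- by move=> a u v; rewrite phi_lin mxtraceD mxtraceZ; case: (\tr _) => p q;
  case: (\tr _) => p' q' /=; ring.
- by move=> u v; rewrite tr_br.
Qed.

(** The matrix of [ad y] in the basis [x]; the invariance of [B] makes it antisymmetric. *)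
Definition structure_coef y i k : R := B (br y (x i)) (x k).

Lemma structure_anti y i k : structure_coef y i k = - structure_coef y k i.
Proof.
by rewrite /structure_coef; have := B_inv y (x i) (x k); rewrite [B (x i) _]B_sym; lra.
Qed.

Lemma rep_structure y i : phi y *m phi (x i) - phi (x i) *m phi y
  = \sum_k (structure_coef y i k)%:C *: phi (x k).
Proof.
rewrite -phi_br [br _ _]x_basis rep_sum; apply: eq_bigr => k _.
by rewrite repZ.
Qed.

Lemma rep_span y : phi y = \sum_i (B y (x i))%:C *: phi (x i).
Proof. by rewrite {1}[y]x_basis rep_sum; apply: eq_bigr => i _; rewrite repZ. Qed.

End Representation.

(** * Consequences of the irreducibility of the symmetric square *)

Lemma mem_lker_linfun (K : fieldType) (aT rT : vectType K) (f : {linear aT -> rT}) v :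
  (v \in lker (linfun f)) = (f v == 0).
Proof. by rewrite memv_ker lfunE. Qed.

Section SymmetricSquare.

Variables (R : realType) (d : nat).
Local Notation C := R[i].

Lemma sym2_spaceE (S : 'M[C]_d) : (S \in sym2_space R d) = (S^T == S).
Proof.
have fl : linear (fun M : 'M[C]_d => M - M^T).
  by move=> a A B; rewrite linearP /= scalerBr opprD addrACA.
pose F : {linear _ -> _} := HB.pack (fun M : 'M[C]_d => M - M^T)
  (GRing.isLinear.Build _ _ _ _ _ fl).
by rewrite /sym2_space -[linfun _]/(linfun F) mem_lker_linfun subr_eq0 eq_sym.
Qed.

Variables (A : Type) (dom : A -> Prop) (rho : A -> 'M[C]_d).
Hypothesis rho_irr : irreducible_on dom (@sym2_act R d) rho (sym2_space R d).

(** Irreducibility in the form used below. Only the zero set of [F] has to be stable, so the target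
    of [F] carries no action. *)
Lemma sym2_irreducible_kernel p q (F : 'M[C]_d -> 'M[C]_(p, q)) : linear F ->
  (forall a S, dom a -> S^T = S -> F S = 0 -> F (sym2_act (rho a) S) = 0) ->
  (forall S, S^T = S -> F S = 0 -> S = 0) \/ (forall S, S^T = S -> F S = 0).
Proof.
move=> Fl Finv.
pose G : {linear _ -> _} := HB.pack F (GRing.isLinear.Build _ _ _ _ _ Fl).
pose W := (sym2_space R d :&: lker (linfun G))%VS.
have memW S : (S \in W) = (S^T == S) && (F S == 0).
  apply: etrans (memv_cap _ _ _) _.
  exact: (f_equal2 andb (sym2_spaceE S) (mem_lker_linfun G S)).
have [_ irr] := rho_irr.
case: (irr W); first exact: capvSl.
- move=> a S da; rewrite !memW => /andP[/eqP Ss /eqP FS].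
  rewrite Finv // eqxx andbT /sym2_act linearD /= !trmx_mul trmxK Ss addrC.
  by rewrite eqxx.
- move=> W0; left=> S Ss FS; apply/eqP; rewrite -memv0 -W0 memW Ss FS !eqxx //.
- move=> WT; right=> S Ss; apply/eqP.
  have : S \in W by rewrite WT sym2_spaceE Ss eqxx.
  by rewrite memW => /andP[].
Qed.

Lemma sym2_irreducible_gt0 : (0 < d)%N.
Proof.
have [+ _] := rho_irr; apply: contraR; rewrite -eqn0Ngt => /eqP d0.
apply/eqP/vspaceP => S; rewrite memv0 sym2_spaceE.
have -> : S = 0 by move: S; rewrite d0 => S; rewrite flatmx0.
by rewrite trmx0 !eqxx.
Qed.

(** The condition [h S = 0] is stable under the action. A nonzero [v^T] in the kernel of [h] gives a
    nonzero symmetric solution [v^T v]; and if all symmetric [S] were solutions, the diagonal units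
    would force [h = 0]. *)
Lemma sym2_intertwiner_unit (h : 'M[C]_d) : h != 0 ->
  (forall a, dom a -> exists b, h *m rho a = b *m h) -> h \in unitmx.
Proof.
move=> h0 hX; case: (@sym2_irreducible_kernel _ _ (mulmx h)) => [| |inj|all0].
- exact: linearP.
- move=> a S da _ hS; have [b hb] := hX a da.
  by rewrite /sym2_act mulmxDr mulmxA hb -mulmxA hS mulmx0 mulmxA hS mul0mx addr0.
- rewrite -unitmx_tr -row_free_unit -kermx_eq0; apply/rowV0P => v /sub_kermxP hv.
  have : v^T *m v = 0.
    apply: inj; first by rewrite trmx_mul trmxK.
    by rewrite mulmxA -[h *m v^T]trmxK trmx_mul trmxK hv trmx0 mul0mx.
  move=> vv; apply/rowP => j; rewrite mxE; apply/eqP.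
  by have /matrixP/(_ j j)/eqP := vv; rewrite !mxE big_ord1 !mxE mulf_eq0 orbb.
- case/eqP: h0; apply/matrixP => i j.
  have hd : h *m delta_mx j j *m 1%:M = 0 by rewrite all0 ?mul0mx // trmx_delta.
  by have /matrixP/(_ i j) := hd; rewrite mul_deltaE !mxE eqxx mulr1.
Qed.

(** Over a closed field [L] has an eigenvector among the symmetric matrices, and its eigenspace is
    stable. The matrix of [L] is formed in a row basis of the vectorized symmetric matrices. *)
Lemma sym2_schur (L : 'M[C]_d -> 'M[C]_d) : linear L ->
  (forall S, S^T = S -> (L S)^T = L S) ->
  (forall a S, dom a -> S^T = S -> L (sym2_act (rho a) S) = sym2_act (rho a) (L S)) ->
  exists c, forall S, S^T = S -> L S = c *: S.
Proof.
move=> Ll Lsym Linv.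
pose G : {linear 'M[C]_d -> 'M[C]_d} := HB.pack L (GRing.isLinear.Build _ _ _ _ _ Ll).
have fl : linear (fun M : 'M[C]_d => M - M^T).
  by move=> a M N; rewrite linearP /= scalerBr opprD addrACA.
pose F : {linear 'M[C]_d -> 'M[C]_d} := HB.pack (fun M : 'M[C]_d => M - M^T)
  (GRing.isLinear.Build _ _ _ _ _ fl).
pose K := kermx (lin_mx F).
have memK v : (v <= K)%MS = ((vec_mx v)^T == vec_mx v).
  rewrite (sameP sub_kermxP eqP) mul_rV_lin /= mxvec_eq0 subr_eq0.
  by rewrite eq_sym.
have K_gt0 : (0 < \rank K)%N.
  rewrite lt0n mxrank_eq0; have d0 := sym2_irreducible_gt0.
  apply/eqP => K0; have := memK (mxvec 1%:M); rewrite K0 submx0 mxvec_eq0 mxvecK trmx1 eqxx.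
  by rewrite -mxrank_eq0 mxrank1 eqn0Ngt d0.
pose P := row_base K *m lin_mx G.
have PK : (P <= row_base K)%MS.
  rewrite eq_row_base; apply/row_subP => i; rewrite memK row_mul mul_rV_lin mxvecK /=.
  by rewrite Lsym //; apply/eqP; rewrite -memK -(eq_row_base K) row_sub.
have [c /eigenvalueP[v vc v0]] := eigenvalue_closed (P *m pinvmx (row_base K)) K_gt0.
pose S0 := vec_mx (v *m row_base K).
have S0K : (v *m row_base K <= K)%MS by apply: submx_trans (submxMl _ _) _; rewrite eq_row_base.
have S0s : S0^T = S0 by apply/eqP; rewrite -memK.
have S0n : S0 != 0.
  by rewrite -mxvec_eq0 vec_mxK mulmx_free_eq0 ?row_base_free.
have LS0 : L S0 = c *: S0.
  have : v *m row_base K *m lin_mx G = c *: (v *m row_base K).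
    by rewrite -mulmxA -/P -(mulmxKpV PK) mulmxA vc scalemxAl.
  by rewrite mul_rV_lin => /(congr1 vec_mx); rewrite mxvecK linearZ.
exists c; case: (@sym2_irreducible_kernel _ _ (fun S => L S - c *: S)) => [| |inj|all0].
- move=> a M N; rewrite Ll scalerBr scalerDr !scalerA [c * a]mulrC opprD.
  by rewrite addrACA.
- move=> a S da Ss; rewrite Linv // => /eqP; rewrite subr_eq0 => /eqP ->.
  by rewrite /sym2_act -scalemxAr -scalemxAl -scalerDr subrr.
- by case/eqP: S0n; apply: inj => //; rewrite LS0 subrr.
- by move=> S Ss; apply/eqP; rewrite -subr_eq0 all0.
Qed.

(** If [W] is stable in [V], the symmetric [S] with image in [W] form a stable subspace of Sym^2 V.
    It contains [w w^T] for every [w] in [W], and it contains the identity only if [W] is all of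
    [V]. *)
Lemma sym2_std_irreducible : irreducible_on dom (@std_act R d) rho fullv.
Proof.
have d0 := sym2_irreducible_gt0; split.
  apply/eqP => full0; have : (delta_mx (Ordinal d0) 0 : 'cV[C]_d) \in 0%VS.
    by rewrite -full0 memvf.
  rewrite memv0 => /eqP/matrixP/(_ (Ordinal d0) 0); rewrite !mxE !eqxx => /eqP.
  by rewrite oner_eq0.
move=> W _ Winv; pose r v := v - projv W v.
have r0 v : (r v == 0) = (v \in W).
  rewrite subr_eq0 eq_sym; apply/eqP/idP => [<-|/projv_id //].
  exact: memv_proj.
have rl : linear r by move=> a u v; rewrite /r linearP scalerBr opprD addrACA.
clearbody r; pose F (S : 'M[C]_d) := \matrix_(i, j) r (col j S) i 0.
have FE S : (F S = 0) <-> forall u, S *m u \in W.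
  split=> [F0 u|SW].
    have cW j : col j S \in W.
      rewrite -r0; apply/eqP/matrixP => i k; rewrite (ord1 k) mxE.
      by have /matrixP/(_ i j) := F0; rewrite !mxE.
    have -> : S *m u = \sum_j u j 0 *: col j S.
      apply/matrixP => i k; rewrite (ord1 k) summxE mxE.
      by apply: eq_bigr => j _; rewrite !mxE mulrC.
    apply: memv_suml => j _; apply: memvZ; exact: cW.
  apply/matrixP => i j; rewrite !mxE; have /eqP -> : r (col j S) == 0.
    by rewrite r0 colE SW.
  by rewrite mxE.
case: (@sym2_irreducible_kernel _ _ F) => [| |inj|all0].
- by move=> a M N; apply/matrixP => i j; rewrite !mxE linearP rl !mxE.
- move=> a S da _ /FE SW; apply/FE => u; rewrite /sym2_act mulmxDl -!mulmxA.
  by apply: memvD; [apply: (Winv a) => //|]; apply: SW.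
- left; apply/vspaceP => w; rewrite memv0; apply/idP/eqP => [wW|->]; last exact: mem0v.
  have ww : w *m w^T = 0.
    apply: inj; first by rewrite trmx_mul trmxK.
    apply/FE => u; rewrite -mulmxA [w^T *m u]mx11_scalar -scalemx1 -scalemxAr mulmx1.
    exact: memvZ.
  apply/matrixP => i j; rewrite (ord1 j) mxE; apply/eqP.
  by have /matrixP/(_ i i)/eqP := ww; rewrite !mxE big_ord1 !mxE mulf_eq0 orbb.
- right; apply/vspaceP => w; rewrite memvf.
  have /FE/(_ w) := all0 1%:M (trmx1 _ _).
  by rewrite mul1mx.
Qed.

End SymmetricSquare.

(** * Highest weights *)

Lemma conj_mulE (K : pzRingType) d N m (P : 'M[K]_(d, N)) (Q : 'M[K]_(N, d))
    (S : 'M[K]_N) (T : 'M[K]_(N, m)) :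
  Q *m P = 1%:M -> P *m S *m Q *m (P *m T) = P *m (S *m T).
Proof. by move=> QP; rewrite !mulmxA -[P *m S *m Q *m P]mulmxA QP mulmx1. Qed.

Lemma conj_cancel (K : pzRingType) d N (P : 'M[K]_(d, N)) (Q : 'M[K]_(N, d)) (S : 'M[K]_N) :
  Q *m P = 1%:M -> Q *m (P *m S *m Q) *m P = S.
Proof. by move=> QP; rewrite !mulmxA QP mul1mx -mulmxA QP mulmx1. Qed.

(** For [F] the adjoint of [E] and [j] the imaginary unit, this reassembles [E] from the two
    skew-Hermitian parts used in [cplx_rep]. *)
Lemma half_sum_diff (K : numFieldType) (V : lmodType K) (E F : V) (j : K) : j != 0 ->
  2%:R^-1 *: (E - F) + j *: ((2%:R * j)^-1 *: (E + F)) = E.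
Proof.
move=> j0; rewrite scalerA invfM mulrCA mulfV // mulr1 -scalerDr addrACA addNr addr0.
by rewrite -mulr2n -scaler_nat scalerA mulVf ?scale1r ?pnatr_eq0.
Qed.

Lemma conj_lin (K : comPzRingType) d N (P : 'M[K]_(d, N)) (Q : 'M[K]_(N, d)) j (S T : 'M[K]_N) :
  P *m S *m Q + j *: (P *m T *m Q) = P *m (S + j *: T) *m Q.
Proof. by rewrite mulmxDr mulmxDl -scalemxAr -scalemxAl. Qed.

Section Assembly.

Variables (R : realType) (g : vectType R) (br : g -> g -> g) (d : nat) (phi : g -> 'M[R[i]]_d).
Hypothesis phi_rep : lie_rep br phi.
Hypothesis phi_inj : injective phi.

Variables (N : nat) (dom : 'M[R[i]]_N -> Prop) (P : 'M[R[i]]_(d, N)) (Q : 'M[R[i]]_(N, d)).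
Hypothesis PQ : P *m Q = 1%:M.
Hypothesis QP : Q *m P = 1%:M.
Hypothesis domE : forall Z, dom Z <-> exists y, phi y = P *m Z *m Q.

(* Junk value [0] outside [dom]. *)
Definition transport (Z : 'M[R[i]]_N) : g :=
  if pselect (exists y, phi y = P *m Z *m Q) is left h then projT1 (cid h) else 0.

Lemma transportE Z : dom Z -> phi (transport Z) = P *m Z *m Q.
Proof.
move=> /domE h; rewrite /transport; case: pselect => // h'.
exact: (projT2 (cid h')).
Qed.

Lemma conj_inj Z Z' : P *m Z *m Q = P *m Z' *m Q -> Z = Z'.
Proof.
by move=> /(congr1 (fun A => Q *m A *m P)); rewrite !conj_cancel.
Qed.

Lemma transport_surj y : exists2 Z, dom Z & transport Z = y.
Proof.
have e : phi y = P *m (Q *m phi y *m P) *m Q.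
  by rewrite conj_cancel.
have dZ : dom (Q *m phi y *m P) by apply/domE; exists y.
by exists (Q *m phi y *m P) => //; apply: phi_inj; rewrite transportE -?e.
Qed.

Lemma transport_iso : lie_iso_from dom br transport.
Proof.
have [lin brE] := phi_rep; split.
- move=> a X Y dX dY.
  have e : phi (a *: transport X + transport Y) = P *m (a%:C *: X + Y) *m Q.
    by rewrite lin !transportE // mulmxDr mulmxDl -scalemxAr -scalemxAl.
  apply: phi_inj; rewrite e transportE //.
  by apply/domE; exists (a *: transport X + transport Y).
- move=> X Y dX dY.
  have e : phi (br (transport X) (transport Y)) = P *m (X *m Y - Y *m X) *m Q.
    have prod (S T : 'M[R[i]]_N) : P *m S *m Q *m (P *m T *m Q) = P *m (S *m T) *m Q.
      by rewrite -[P *m T *m Q]mulmxA conj_mulE // !mulmxA.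
    by rewrite brE !transportE // !prod mulmxBr mulmxBl.
  apply: phi_inj; rewrite e transportE //.
  by apply/domE; exists (br (transport X) (transport Y)).
- move=> X Y dX dY /(congr1 phi); rewrite !transportE //; exact: conj_inj.
- exact: transport_surj.
Qed.

(** On [dom] the transported representation is [Z |-> P Z Q]. This formula is complex linear, so it
    persists for [E] once both of its skew-Hermitian parts are in [dom]. *)
Lemma cplx_transport E : dom ((2%:R)^-1 *: (E - ctr E)) ->
  dom (((2%:R) * 'i%C)^-1 *: (E + ctr E)) ->
  cplx_rep (fun X => phi (transport X)) E = P *m E *m Q.
Proof.
move=> d1 d2; have i0 : 'i%C != 0 :> R[i] by apply: neq0Ci.
have eE := half_sum_diff E (ctr E) i0.
apply: (etrans (f_equal2 (fun S T => S + 'i%C *: T) (transportE d1) (transportE d2))).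
apply: (etrans (conj_lin P Q 'i%C _ _)).
by apply: (f_equal (fun S => P *m S *m Q)); exact: eE.
Qed.

Hypothesis phi_irr : irreducible_on (fun _ : g => True) (@sym2_act R d) phi (sym2_space R d).

Lemma transport_irreducible m n (act : 'M[R[i]]_d -> 'M[R[i]]_(m, n) -> 'M[R[i]]_(m, n)) W0 :
  irreducible_on (fun _ : g => True) act phi W0 ->
  irreducible_on dom act (fun X => phi (transport X)) W0.
Proof.
move=> [n0 irr]; split=> // W WW0 Winv; apply: irr => // y v _ vW.
by have [Z dZ <-] := transport_surj y; apply: Winv.
Qed.

Variables (l : nat) (pos : 'M[R[i]]_N -> Prop) (coroot : 'I_l -> 'M[R[i]]_N).
Variables (e : 'cV[R[i]]_N) (x : 'I_l -> nat).
Hypothesis e_neq0 : e != 0.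
Hypothesis cplx_dom : forall E, pos E \/ (exists k, E = coroot k) ->
  dom ((2%:R)^-1 *: (E - ctr E)) /\ dom (((2%:R) * 'i%C)^-1 *: (E + ctr E)).
Hypothesis pos_e : forall E, pos E -> E *m e = 0.
Hypothesis coroot_e : forall k, coroot k *m e = (x k)%:R *: e.

Lemma conj_actE E : P *m E *m Q *m (P *m e) = P *m (E *m e).
Proof. exact: conj_mulE. Qed.

Lemma transport_std_hw :
  irrep_with_hw dom pos coroot (@std_act R d) (fun X => phi (transport X)) fullv x.
Proof.
split; first exact/transport_irreducible/sym2_std_irreducible/phi_irr.
exists (P *m e); split; first exact: memvf.
- apply: contraNneq e_neq0 => Pe; have : Q *m (P *m e) = 0 by rewrite Pe mulmx0.
  by rewrite mulmxA QP mul1mx => ->.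
- move=> E pE; have [d1 d2] := cplx_dom (or_introl pE).
  by rewrite /std_act cplx_transport // conj_actE pos_e // mulmx0.
- move=> k; have [d1 d2] := cplx_dom (or_intror (ex_intro _ k erefl)).
  by rewrite /std_act cplx_transport // conj_actE coroot_e -scalemxAr.
Qed.

(** The highest weight vector is the square [v v^T] of the one in [V]; acting as a derivation
    doubles the weight. *)
Lemma transport_sym2_hw x2 : (forall k, x2 k = 2 * x k)%N ->
  irrep_with_hw dom pos coroot (@sym2_act R d) (fun X => phi (transport X)) (sym2_space R d) x2.
Proof.
move=> x2E; split; first exact/transport_irreducible/phi_irr.
pose v := P *m e; exists (v *m v^T).
have act E : dom ((2%:R)^-1 *: (E - ctr E)) -> dom (((2%:R) * 'i%C)^-1 *: (E + ctr E)) ->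
    sym2_act (cplx_rep (fun X => phi (transport X)) E) (v *m v^T)
    = (P *m (E *m e)) *m v^T + v *m (P *m (E *m e))^T.
  move=> d1 d2; rewrite /sym2_act cplx_transport // mulmxA conj_actE -/v.
  by rewrite -conj_actE -/v -[in X in _ + X]mulmxA -trmx_mul.
split.
- by rewrite sym2_spaceE trmx_mul trmxK eqxx.
- apply: contraNneq e_neq0 => vv; apply/eqP/matrixP => i j; rewrite (ord1 j) mxE.
  have : Q *m (v *m v^T) *m Q^T = 0 by rewrite vv mulmx0 mul0mx.
  rewrite !mulmxA -[_ *m v^T *m Q^T]mulmxA -trmx_mul /v !mulmxA QP mul1mx.
  by move/matrixP/(_ i i)/eqP; rewrite !mxE big_ord1 !mxE mulf_eq0 orbb => /eqP.
- move=> E pE; have [d1 d2] := cplx_dom (or_introl pE).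
  by rewrite act // pos_e // mulmx0 mul0mx trmx0 mulmx0 addr0.
- move=> k; have [d1 d2] := cplx_dom (or_intror (ex_intro _ k erefl)).
  rewrite act // coroot_e -scalemxAr -/v linearZ /= -scalemxAl -scalemxAr -scalerDl.
  by rewrite x2E mul2n -addnn natrD.
Qed.

End Assembly.

(** * Dimension of the symmetric square, complexifications, root vectors *)

Lemma card_le_pairs d : #|[pred p : 'I_d * 'I_d | (p.1 <= p.2)%N]| = 'C(d.+1, 2).
Proof.
rewrite -sum1_card -(pair_big_dep xpredT (fun i j : 'I_d => (i <= j)%N) (fun _ _ => 1%N)) /=.
rewrite (exchange_big_dep xpredT) //= -bin2_sum big_nat_recl // add0n big_mkord.
apply: eq_bigr => j _.
have := @big_ord_narrow _ 0%N addn j.+1 d (fun=> 1%N) (ltn_ord j).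
rewrite [RHS]sum1_card card_ord => e.
transitivity (\sum_(i < d | (i < j.+1)%N) 1)%N; last exact: e.
by apply: eq_bigl.
Qed.

(** Symmetric matrices are parametrized linearly by their entries on and above the diagonal; [srt]
    sends a position to its representative there. *)
Lemma dim_sym2_space (R : realType) d : \dim (sym2_space R d) = 'C(d.+1, 2).
Proof.
rewrite -card_le_pairs; set A := [pred p : 'I_d * 'I_d | (p.1 <= p.2)%N].
case: d => [|d] in A *.
  rewrite eq_card0 => [|[[]]//]; apply/eqP; rewrite dimv_eq0; apply/eqP/vspaceP => S.
  by rewrite memv0 sym2_spaceE [S]flatmx0 trmx0 !eqxx.
have A0 : (ord0, ord0) \in A by [].
pose srt (i j : 'I_d.+1) := if (i <= j)%N then (i, j) else (j, i).
have srtA i j : srt i j \in A by rewrite /srt; case: leqP => [h|/ltnW h]; exact: h.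
have srtC i j : srt i j = srt j i.
  rewrite /srt; case: (ltngtP i j) => // /val_inj ->.
  by [].
pose F (h : 'rV[R[i]]_#|A|) := \matrix_(i, j) h 0 (enum_rank_in A0 (srt i j)).
have Fl : linear F by move=> a u v; apply/matrixP => i j; rewrite !mxE.
pose G : {linear _ -> _} := HB.pack F (GRing.isLinear.Build _ _ _ _ _ Fl).
have FE h k : F h (enum_val k).1 (enum_val k).2 = h 0 k.
  rewrite mxE; have := enum_valP k; rewrite inE => le.
  by rewrite /srt le -surjective_pairing enum_valK_in.
have -> : sym2_space R d.+1 = limg (linfun G).
  apply/vspaceP => S; rewrite sym2_spaceE; apply/eqP/memv_imgP => [Ss|[h _ ->]].
    exists (\row_k S (enum_val k).1 (enum_val k).2); first exact: memvf.
    rewrite lfunE /=; apply/matrixP => i j; rewrite !mxE enum_rankK_in //.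
    rewrite /srt; case: leqP => //= _.
    by rewrite -[in LHS]Ss mxE.
  by rewrite lfunE /=; apply/matrixP => i j; rewrite !mxE srtC.
rewrite limg_dim_eq ?dimvf ?dim_matrix ?mul1r //; apply/vspaceP => h.
rewrite memv0 memv_cap memvf memv_ker lfunE /=; apply/eqP/eqP => [F0|->].
  by apply/rowP => k; rewrite -FE F0 !mxE.
by apply/matrixP => i j; rewrite !mxE.
Qed.

Section Complexification.

Variable R : realType.

Lemma ctr_half_diff N (E : 'M[R[i]]_N) :
  ctr (2%:R^-1 *: (E - ctr E)) = - (2%:R^-1 *: (E - ctr E)).
Proof.
rewrite !ctr_adj adjZ adjB trmxCK fmorphV /= conjC_nat -scalerN opprB.
by [].
Qed.

Lemma ctr_half_sum N (E : 'M[R[i]]_N) :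
  ctr ((2%:R * 'i%C)^-1 *: (E + ctr E)) = - ((2%:R * 'i%C)^-1 *: (E + ctr E)).
Proof.
rewrite !ctr_adj adjZ adjD trmxCK fmorphV /= rmorphM /= conjC_nat -scaleNr addrC.
have -> : ('i%C : R[i])^*%R = - 'i%C by apply/eqP; rewrite eq_complex /= oppr0 !eqxx.
by rewrite mulrN invrN.
Qed.

Lemma su_complexification l (E : 'M[R[i]]_l.+1) : \tr E = 0 ->
  su_mem (2%:R^-1 *: (E - ctr E)) /\ su_mem ((2%:R * 'i%C)^-1 *: (E + ctr E)).
Proof.
move=> trE; have trC : \tr (ctr E) = 0 by rewrite ctr_adj tr_adj trE conjC0.
split; split; rewrite ?ctr_half_diff ?ctr_half_sum //.
  by rewrite mxtraceZ (raddfB (@mxtrace R[i] l.+1)) /= trE trC subrr mulr0.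
by rewrite mxtraceZ mxtraceD trE trC addr0 mulr0.
Qed.

(** The equation of complex sp is linear and, since [J^* = - J] and [J^2 = - 1], stable under the
    adjoint; both skew-Hermitian parts of [E] inherit it. *)
Lemma sp_complexification l (E : 'M[R[i]]_(l + l)) :
  E^T *m sympJ R l + sympJ R l *m E = 0 ->
  sp_mem (2%:R^-1 *: (E - ctr E)) /\ sp_mem ((2%:R * 'i%C)^-1 *: (E + ctr E)).
Proof.
move=> EJ.
have spD (a b : R[i]) (S T : 'M[R[i]]_(l + l)) :
    S^T *m sympJ R l + sympJ R l *m S = 0 -> T^T *m sympJ R l + sympJ R l *m T = 0 ->
    (a *: (S + b *: T))^T *m sympJ R l + sympJ R l *m (a *: (S + b *: T)) = 0.
  move=> S0 T0; rewrite linearZ linearD linearZ /= -!scalemxAl -!scalemxAr -scalerDr.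
  rewrite mulmxDl mulmxDr -scalemxAl -scalemxAr addrACA S0 -scalerDr T0.
  by rewrite scaler0 addr0 scaler0.
have CJ : (ctr E)^T *m sympJ R l + sympJ R l *m ctr E = 0.
  have JJ := sympJK R l; have JA := adj_sympJ R l; rewrite ctr_adj.
  have := congr1 (fun A => A^t*) EJ; rewrite adjD !adjM JA trmx0 map_mx0.
  rewrite mulNmx mulmxN -opprD => /eqP; rewrite oppr_eq0 addr_eq0 => /eqP e.
  have -> : (E^t*)^T = (E^T)^t* by rewrite map_trmx.
  move: (sympJ R l) ((E^T)^t*) (E^t*) e JJ => J S T e JJ.
  have := congr1 (fun A => J *m A *m J) e.
  rewrite mulmxA JJ mulNmx mul1mx mulmxN !mulNmx -!mulmxA JJ !mulmxN mulmx1 opprK => eJ.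
  by rewrite -eJ addrN.
split; split; rewrite ?ctr_half_diff ?ctr_half_sum //.
  by have := spD 2%:R^-1 (-1) _ _ EJ CJ; rewrite scaleN1r.
by have := spD (2%:R * 'i%C)^-1 1 _ _ EJ CJ; rewrite scale1r.
Qed.

End Complexification.

Section HighestWeights.

Variable R : realType.
Local Notation C := R[i].

Lemma hw_first2 l k : @hw_first l 2 k = (2 * hw_first 1 k)%N.
Proof. by rewrite /hw_first; case: ifP. Qed.

Lemma su_pos_dom l (E : 'M[C]_l.+1) : su_pos E \/ (exists k : 'I_l, E = su_coroot R k) ->
  \tr E = 0.
Proof.
move=> [[i [j [ij ->]]]|[k ->]].
  rewrite -[delta_mx i j]mulmx1 tr_delta_mul mxE; have [e|//] := eqVneq j i.
  by rewrite e ltnn in ij.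
rewrite (raddfB (@mxtrace C l.+1)) /= -[X in \tr X - _]mulmx1 -[X in _ - \tr X]mulmx1.
by rewrite !tr_delta_mul !mxE !eqxx subrr.
Qed.

Lemma su_pos_kill l (E : 'M[C]_l.+1) : su_pos E -> E *m delta_mx 0 0 = 0 :> 'cV_l.+1.
Proof.
move=> [i [j [ij ->]]]; rewrite mul_delta_mx_0 //.
by apply: contraTneq ij => ->.
Qed.

Lemma su_coroot_weight l (k : 'I_l) :
  su_coroot R k *m delta_mx 0 0 = (hw_first 1 k)%:R *: delta_mx 0 0 :> 'cV_l.+1.
Proof.
rewrite /su_coroot mulmxBl [X in _ - X]mul_delta_mx_0 // subr0 mul_delta_mx_cond /hw_first.
have -> : (widen_ord (leqnSn l) k == 0) = (val k == 0%N) by [].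
case: eqP => k0; last by rewrite scale0r.
by rewrite scale1r; congr (delta_mx _ _); apply: val_inj.
Qed.

Lemma J_lshift l p (i : 'I_l) (q : 'I_p) :
  sympJ R l *m delta_mx (lshift l i) q = - delta_mx (rshift l i) q.
Proof.
apply/matrixP => a b; rewrite -[_ *m _]mulmx1 mul_deltaE -[a]splitK.
case: (split a) => a' /=; rewrite /sympJ ?block_mxEul ?block_mxEdl !mxE ?eq_lrshift ?eq_rshift.
  by rewrite mul0r oppr0.
by rewrite [q == b]eq_sym mulNr -natrM mulnb.
Qed.

Lemma J_rshift l p (i : 'I_l) (q : 'I_p) :
  sympJ R l *m delta_mx (rshift l i) q = delta_mx (lshift l i) q.
Proof.
apply/matrixP => a b; rewrite -[_ *m _]mulmx1 mul_deltaE -[a]splitK.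
case: (split a) => a' /=; rewrite /sympJ ?block_mxEur ?block_mxEdr !mxE ?eq_rlshift ?eq_lshift.
  by rewrite [q == b]eq_sym -natrM mulnb.
by rewrite mul0r.
Qed.

Lemma lshift_J l p (i : 'I_l) (q : 'I_p) :
  delta_mx q (lshift l i) *m sympJ R l = delta_mx q (rshift l i).
Proof.
by apply: trmx_inj; rewrite trmx_mul tr_sympJ !trmx_delta mulNmx J_lshift opprK.
Qed.

Lemma rshift_J l p (i : 'I_l) (q : 'I_p) :
  delta_mx q (rshift l i) *m sympJ R l = - delta_mx q (lshift l i).
Proof.
by apply: trmx_inj; rewrite trmx_mul tr_sympJ linearN /= !trmx_delta mulNmx J_rshift.
Qed.

Definition in_sp l (E : 'M[C]_(l + l)) := E^T *m sympJ R l + sympJ R l *m E = 0.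

Lemma sp_short_root l (i j : 'I_l) :
  in_sp (delta_mx (lshift l i) (lshift l j) - delta_mx (rshift l j) (rshift l i)).
Proof.
rewrite /in_sp linearB /= !trmx_delta mulmxBl mulmxBr lshift_J rshift_J J_lshift J_rshift.
by rewrite opprK -opprD [X in _ - X]addrC subrr.
Qed.

Lemma sp_long_root l (i j : 'I_l) :
  in_sp (delta_mx (lshift l i) (rshift l j) + delta_mx (lshift l j) (rshift l i)).
Proof.
rewrite /in_sp linearD /= !trmx_delta mulmxDl mulmxDr !lshift_J !J_lshift.
by rewrite -opprD [X in _ - X]addrC subrr.
Qed.

Lemma sp_pos_dom l (E : 'M[C]_(l + l)) :
  sp_pos E \/ (exists k : 'I_l, E = sp_coroot R k) -> in_sp E.
Proof.
move=> [[[i [j [_ ->]]]|[i [j [_ ->]]]]|[k ->]]; first exact: sp_short_root.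
  exact: sp_long_root.
(* [sp_h] is the formula of [sp_short_root] at [i = j]. *)
rewrite /sp_coroot; case: ifP => _; last exact: sp_short_root.
rewrite /in_sp linearB /= mulmxBl mulmxBr addrACA -opprD !sp_short_root.
by rewrite subr0.
Qed.

Variables (l : nat) (l_gt0 : (0 < l)%N).
Let o : 'I_l := Ordinal l_gt0.

Lemma sp_pos_kill (E : 'M[C]_(l + l)) : sp_pos E ->
  E *m delta_mx (lshift l o) 0 = 0 :> 'cV_(l + l).
Proof.
move=> [[i [j [ij ->]]]|[i [j [ij ->]]]].
  rewrite mulmxBl !mul_delta_mx_0 ?subrr ?eq_rlshift // eq_lshift.
  by apply: contraTneq ij => ->.
by rewrite mulmxDl !mul_delta_mx_0 ?addr0 ?eq_rlshift.
Qed.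

Lemma sp_h_weight k : sp_h R k *m delta_mx (lshift l o) 0
  = (k == o)%:R *: delta_mx (lshift l o) 0 :> 'cV_(l + l).
Proof.
rewrite /sp_h mulmxBl [X in _ - X]mul_delta_mx_0 ?eq_rlshift // subr0 mul_delta_mx_cond.
rewrite eq_lshift; have [-> | _] := eqVneq k o; first by rewrite scale1r.
by rewrite scale0r.
Qed.

Lemma sp_coroot_weight (k : 'I_l) :
  sp_coroot R k *m delta_mx (lshift l o) 0
  = (hw_first 1 k)%:R *: delta_mx (lshift l o) 0 :> 'cV_(l + l).
Proof.
have hE : (hw_first 1 k)%:R = (k == o)%:R :> C.
  by rewrite /hw_first; have -> : (k == o) = (val k == 0%N) by []; case: eqP.
rewrite /sp_coroot hE; case: ifP => kl; last exact: sp_h_weight.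
(* In this branch [k.+1 < l], so [insubd] returns the true successor and not its default [k]. *)
rewrite mulmxBl !sp_h_weight; have -> : (insubd k k.+1 == o) = false.
  by rewrite -val_eqE val_insubd kl.
by rewrite scale0r subr0.
Qed.

End HighestWeights.

(** * Invariance of the Casimir tensor and conclusion *)

Lemma sum_antisym (K : pzRingType) (V : lmodType K) n (O : 'I_n -> 'I_n -> K)
    (f : 'I_n -> 'I_n -> V) : (forall i k, O i k = - O k i) ->
  \sum_i \sum_k O i k *: (f k i + f i k) = 0.
Proof.
move=> anti.
have e : \sum_i \sum_k O i k *: f i k = - \sum_i \sum_k O i k *: f k i.
  rewrite exchange_big -sumrN; apply: eq_bigr => i _; rewrite -sumrN.
  by apply: eq_bigr => k _; rewrite anti scaleNr.
transitivity (\sum_i \sum_k O i k *: f k i + \sum_i \sum_k O i k *: f i k).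
  rewrite -big_split; apply: eq_bigr => i _; rewrite -big_split.
  by apply: eq_bigr => k _; rewrite scalerDr.
by rewrite e subrr.
Qed.

(** [ad Z] acts on the family through an antisymmetric matrix, so its contributions to the two
    factors of [sum_i X_i (x) X_i] cancel. *)
Lemma casimir_sandwich_comm (K : comPzRingType) n d (X : 'I_n -> 'M[K]_d) Z O (S : 'M[K]_d) :
  (forall i k, O i k = - O k i) ->
  (forall i, Z *m X i - X i *m Z = \sum_k O i k *: X k) ->
  \sum_i X i *m (Z *m S + S *m Z^T) *m (X i)^T
  = Z *m (\sum_i X i *m S *m (X i)^T) + (\sum_i X i *m S *m (X i)^T) *m Z^T.
Proof.
move=> anti br; apply/eqP; rewrite eq_sym -subr_eq0; apply/eqP.
rewrite mulmx_sumr mulmx_suml -big_split -sumrB /=.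
transitivity (\sum_i \sum_k O i k *: (X k *m S *m (X i)^T + X i *m S *m (X k)^T)).
  apply: eq_bigr => i _.
  transitivity ((Z *m X i - X i *m Z) *m S *m (X i)^T
      + X i *m S *m (Z *m X i - X i *m Z)^T).
    rewrite linearB /= !trmx_mul !mulmxBl !mulmxBr mulmxDr mulmxDl !mulmxA.
    by rewrite opprD addrACA.
  rewrite br linear_sum mulmx_sumr !mulmx_suml -big_split /=; apply: eq_bigr => k _.
  by rewrite linearZ /= -!scalemxAl -scalemxAr scalerDr.
exact: (sum_antisym (fun k i => X k *m S *m (X i)^T)).
Qed.

(** The same cancellation: the antisymmetry of [O] moves [ad Z] from the trace to the matrix factor
    in each [tr (A X_i) X_i]. *)
Lemma cas_inv_of_structure (R : rcfType) n d (X : 'I_n -> 'M[R[i]]_d) Z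
    (O : 'I_n -> 'I_n -> R[i]) :
  (forall i k, O i k = - O k i) ->
  (forall i, Z *m X i - X i *m Z = \sum_k O i k *: X k) -> cas_equiv X Z.
Proof.
move=> anti br A; rewrite !casE mulmxN mulNmx opprK [RHS]addrC -[RHS]opprB; congr (- _).
rewrite mulmx_sumr mulmx_suml -sumrB.
have trO i : \tr ((Z *m A - A *m Z) *m X i) = - \sum_k O i k * \tr (A *m X k).
  transitivity (- \tr (A *m (Z *m X i - X i *m Z))).
    rewrite mulmxBl mulmxBr !(raddfB (@mxtrace R[i] d)) /= opprB !mulmxA; congr (_ - _).
    by rewrite -[Z *m A *m X i]mulmxA [LHS]mxtrace_mulC.
  rewrite br mulmx_sumr (raddf_sum (@mxtrace R[i] d)); congr (- _).
  by apply: eq_bigr => k _ /=; rewrite -scalemxAr mxtraceZ.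
transitivity (\sum_i \sum_k - (O i k * \tr (A *m X k)) *: X i).
  by apply: eq_bigr => i _; rewrite trO -scaler_suml sumrN.
rewrite exchange_big; apply: eq_bigr => k _ /=.
rewrite -scalemxAl -scalemxAr -scalerBr br scaler_sumr.
by apply: eq_bigr => i _; rewrite anti mulNr opprK scalerA mulrC.
Qed.

Section MainProof.

Variables (R : realType) (g : vectType R) (br : g -> g -> g) (d : nat) (phi : g -> 'M[R[i]]_d).
Hypothesis br_ss : lie_semisimple br.
Hypothesis br_compact : lie_compact br.
Hypothesis phi_rep : lie_rep br phi.
Hypothesis phi_inj : injective phi.
Hypothesis phi_irr : irreducible_on (fun _ : g => True) (@sym2_act R d) phi (sym2_space R d).

Definition rep_realizes N (dom : 'M[R[i]]_N -> Prop) :=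
  exists (P : 'M[R[i]]_(d, N)) (Q : 'M[R[i]]_(N, d)), [/\ P *m Q = 1%:M, Q *m P = 1%:M &
    forall Z, dom Z <-> exists y, phi y = P *m Z *m Q].

Theorem rep_normal_form : exists2 l, (0 < l)%N &
  d = (l + l)%N /\ rep_realizes (@sp_mem R l) \/ d = l.+1 /\ rep_realizes (@su_mem R l.+1).
Proof.
have [B [B_lin B_sym B_pos B_inv]] := br_compact.
have [n [x [_ x_basis]]] := orthonormal_basis B_lin B_sym B_pos.
have d0 := sym2_irreducible_gt0 phi_irr.
pose X i := phi (x i).
have spanX y : phi y = \sum_i (B y (x i))%:C *: X i := rep_span phi_rep x_basis y.
have structX := rep_structure phi_rep x_basis.
have anti := structure_anti B_sym B_inv x.
have antiC y i k : (structure_coef br B x y i k)%:C = - (structure_coef br B x y k i)%:C :> R[i].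
  by rewrite anti rmorphN.
(* Irreducibility concerns all [phi y], the minimization only the basis elements; a linear
   combination of the [Y i] bridges the two. *)
have interX (h : 'M[R[i]]_d) (Y : 'I_n -> 'M[R[i]]_d) :
    h != 0 -> (forall i, h *m X i = Y i *m h) -> h \in unitmx.
  move=> h0 hX; apply: (sym2_intertwiner_unit phi_irr h0) => y _.
  exists (\sum_i (B y (x i))%:C *: Y i); rewrite spanX mulmx_sumr mulmx_suml.
  by apply: eq_bigr => i _; rewrite -scalemxAr hX scalemxAl.
have [h [Y [hu hX Ymin]]] := minimal_conjugate interX d0.
have YE i : Y i = h *m X i *m invmx h by rewrite hX mulmxK.
have structY j i : Y j *m Y i - Y i *m Y j
    = \sum_k (structure_coef br B x (x j) i k)%:C *: Y k.
  have prod p q : Y p *m Y q *m h = h *m (X p *m X q).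
    by rewrite -mulmxA -hX mulmxA -hX mulmxA.
  rewrite -[LHS](mulmxK hu) mulmxBl !prod -mulmxBr structX mulmx_sumr mulmx_suml.
  by apply: eq_bigr => k _; rewrite -scalemxAr -scalemxAl -YE.
have trY i : \tr (Y i) = 0.
  by rewrite YE mxtrace_mulC mulmxA mulVmx // mul1mx (rep_trace br_ss phi_rep phi_inj B_lin
    B_sym B_pos B_inv x_basis).
(* Schur's lemma for [Y]: if [A - a] is nonzero, [(A - a) h] intertwines [X] with [Y] and is
   invertible, although [A - a] kills the eigenvector [v]. *)
have commY A : (forall i, A *m Y i - Y i *m A = 0) -> exists a, A = a%:M.
  move=> AY; have [a /eigenvalueP[v va v0]] := eigenvalue_closed A d0; exists a.
  apply/eqP; rewrite -subr_eq0; apply/negPn/negP => Aa.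
  have Aah : (A - a%:M) *m h \in unitmx.
    apply: (@interX _ Y) => [|i].
      by apply: contraNneq Aa => e; rewrite -[A - _](mulmxK hu) e mul0mx.
    rewrite -mulmxA hX !mulmxA; congr (_ *m _).
    by rewrite mulmxBl mulmxBr (eqP _ : A *m Y i = Y i *m A) ?scalar_mxC // -subr_eq0 AY.
  have Aau : A - a%:M \in unitmx by move: Aah; rewrite unitmx_mul => /andP[].
  case/eqP: v0; rewrite -[v](mulmxK Aau) mulmxBr va mul_mx_scalar subrr mul0mx.
  by [].
have skY : forall i, (Y i)^t* = - Y i.
  apply: (@moment_zero_skew _ n d Y _ trY d0
    (fun j i k => (structure_coef br B x (x j) i k)%:C)) => //.
  - exact: (minimal_moment Ymin d0).
  - by move=> j i k; exact: conjC_real.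
(* The scalar is found for [X], to which the irreducibility of [phi] applies directly; it is carried
   over to [Y] by the congruence [S = h S' h^T]. *)
have [c cX] : exists c, forall S, S^T = S -> \sum_i X i *m S *m (X i)^T = c *: S.
  apply: (sym2_schur phi_irr (L := fun S => \sum_i X i *m S *m (X i)^T)).
  - move=> a S T; rewrite scaler_sumr -big_split; apply: eq_bigr => i _ /=.
    by rewrite mulmxDr mulmxDl -scalemxAr -scalemxAl.
  - move=> S Ss; rewrite linear_sum; apply: eq_bigr => i _.
    by rewrite /= !trmx_mul trmxK Ss mulmxA.
  - by move=> y S _ _; apply: (casimir_sandwich_comm _ (antiC y) (structX y)).
have Y_fam : casimir_family c Y.
  split=> //.
  - by move=> j; apply: (cas_inv_of_structure (antiC (x j)) (structY j)).
  - move=> S Ss; pose S' := invmx h *m S *m (invmx h)^T.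
    have S's : S'^T = S' by rewrite /S' !trmx_mul trmxK Ss mulmxA.
    have hS : S = h *m S' *m h^T.
      rewrite /S' !mulmxA mulmxV // mul1mx -mulmxA -trmx_mul mulmxV //.
      by rewrite trmx1 mulmx1.
    transitivity (h *m (\sum_i X i *m S' *m (X i)^T) *m h^T); last first.
      by rewrite cX // -scalemxAr -scalemxAl -hS.
    rewrite mulmx_sumr mulmx_suml; apply: eq_bigr => i _.
    have -> : h *m (X i *m S' *m (X i)^T) *m h^T = h *m X i *m S' *m (h *m X i)^T.
      by rewrite trmx_mul !mulmxA.
    by rewrite hX trmx_mul {1}hS !mulmxA.
  - apply/existsP; rewrite -[X in is_true X]negbK negb_exists; apply/negP => /forallP Y0.
    have [[y y0] _] := br_ss; case/eqP: y0; apply: phi_inj; rewrite (rep0 phi_rep) spanX.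
    rewrite big1 // => i _; have := Y0 i; rewrite negbK => /eqP Yi0.
    by rewrite -[X i](mulKmx hu) hX Yi0 mul0mx mulmx0 scaler0.
have toRep N (dom : 'M[R[i]]_N -> Prop) : realizes Y dom -> rep_realizes dom.
  move=> [P [Q [PQ QP domE]]]; exists (invmx h *m P), (Q *m h); split.
  - by rewrite -mulmxA [P *m _]mulmxA PQ mul1mx mulVmx.
  - by rewrite -mulmxA [h *m _]mulmxA mulmxV // mul1mx.
  move=> Z; have [h1 h2] := domE Z.
  have conjr (r : 'I_n -> R) : \sum_i (r i)%:C *: Y i = h *m (\sum_i (r i)%:C *: X i) *m invmx h.
    by rewrite mulmx_sumr mulmx_suml; apply: eq_bigr => i _; rewrite -scalemxAr -scalemxAl -YE.
  have e0 : invmx h *m P *m Z *m (Q *m h) = invmx h *m (P *m Z *m Q) *m h by rewrite !mulmxA.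
  rewrite e0; split=> [/h1[r re]|[y ye]].
    exists (\sum_i r i *: x i).
    have -> : phi (\sum_i r i *: x i) = \sum_i (r i)%:C *: X i.
      by rewrite (rep_sum phi_rep); apply: eq_bigr => i _; rewrite (repZ phi_rep).
    by rewrite -re conjr conj_cancel ?mulVmx.
  apply: h2; exists (fun i => B y (x i)); rewrite conjr -spanX ye.
  by rewrite conj_cancel ?mulmxV.
have [l l0 [[dE real]|[dE real]]] := casimir_family_realizes Y_fam.
  by exists l => //; left; split=> //; apply: toRep.
by exists l => //; right; split=> //; apply: toRep.
Qed.

End MainProof.

Unset Implicit Arguments.

Theorem theorem3 (R : realType) (g : vectType R) (br : g -> g -> g)
    (d : nat) (phi : g -> 'M[R[i]]_d) :
  is_lie_bracket br -> lie_semisimple br -> lie_compact br ->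
  lie_rep br phi -> injective phi ->
  irreducible_on (fun _ : g => True) (@sym2_act R d) phi (sym2_space R d) ->
  (exists l : nat, (0 < l)%N /\
     exists psi : 'M[R[i]]_(l + l) -> g,
       [/\ lie_iso_from (@sp_mem R l) br psi,
           d = (l + l)%N,
           irrep_with_hw (@sp_mem R l) (@sp_pos R l) (@sp_coroot R l)
             (@std_act R d) (fun X => phi (psi X)) fullv (@hw_first l 1),
           \dim (sym2_space R d) = (l.*2.+1 * l)%N &
           irrep_with_hw (@sp_mem R l) (@sp_pos R l) (@sp_coroot R l)
             (@sym2_act R d) (fun X => phi (psi X)) (sym2_space R d) (@hw_first l 2)])
  \/
  (exists l : nat, (0 < l)%N /\
     exists psi : 'M[R[i]]_l.+1 -> g,
       [/\ lie_iso_from (@su_mem R l.+1) br psi,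
           d = l.+1,
           irrep_with_hw (@su_mem R l.+1) (@su_pos R l) (@su_coroot R l)
             (@std_act R d) (fun X => phi (psi X)) fullv (@hw_first l 1),
           \dim (sym2_space R d) = (l.+1 * l.+2 %/ 2)%N &
           irrep_with_hw (@su_mem R l.+1) (@su_pos R l) (@su_coroot R l)
             (@sym2_act R d) (fun X => phi (psi X)) (sym2_space R d) (@hw_first l 2)]).
Proof.
move=> _ ss compact rep inj irr.
have delta_neq0 N (i : 'I_N) : delta_mx i 0 != 0 :> 'cV[R[i]]_N.
  by apply/eqP => /matrixP/(_ i 0)/eqP; rewrite !mxE !eqxx oner_eq0.
have [l l0 [[dE [P [Q [PQ QP domE]]]]|[dE [P [Q [PQ QP domE]]]]]] :=
  rep_normal_form ss compact rep inj irr.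
- left; exists l; split=> //; exists (transport phi P Q).
  have cplx E H := @sp_complexification R l E (sp_pos_dom H).
  split=> //.
  + exact: (transport_iso rep inj PQ QP domE).
  + exact: (transport_std_hw inj PQ QP domE irr (delta_neq0 _ _) cplx
      (@sp_pos_kill R l l0) (@sp_coroot_weight R l l0)).
  + by rewrite dim_sym2_space dE bin2 /= addnn -doubleMr doubleK.
  + exact: (transport_sym2_hw inj PQ QP domE irr (delta_neq0 _ _) cplx
      (@sp_pos_kill R l l0) (@sp_coroot_weight R l l0) (@hw_first2 l)).
- right; exists l; split=> //; exists (transport phi P Q).
  have cplx E H := @su_complexification R l E (su_pos_dom H).
  split=> //.
  + exact: (transport_iso rep inj PQ QP domE).
  + exact: (transport_std_hw inj PQ QP domE irr (delta_neq0 _ _) cplx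
      (@su_pos_kill R l) (@su_coroot_weight R l)).
  + by rewrite dim_sym2_space dE bin2 divn2 mulnC.
  + exact: (transport_sym2_hw inj PQ QP domE irr (delta_neq0 _ _) cplx
      (@su_pos_kill R l) (@su_coroot_weight R l) (@hw_first2 l)).
Qed.
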